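(* Let $X=G/P$ and let $d\in H_2(X)$ be an effective degree. (a) If $\alpha\in R^+$ satisfies $\alpha^\vee+\mathbb{Z}\Delta_P^\vee\le d$, then $s_\alpha\cdot z_{d-\alpha^\vee}^Pw_P\le z_d^Pw_P$. (b) If $0\le d'\le d$ in $H_2(X)$, then $z_{d'}^P\cdot z_{d-d'}^Pw_P\le z_d^Pw_P$. (c) If $\alpha\in R^+\smallsetminus R_P^+$ is a maximal root of $d$, then $s_\alpha\cdot z_{d-\alpha^\vee}^Pw_P=z_d^Pw_P$. (d) For all sufficiently large degrees $e\in H_2(G/B)=\mathbb{Z}\Delta^\vee$ such that $e+\mathbb{Z}\Delta_P^\vee=d\in H_2(X)$ we have $z_d^Pw_P=z_e$. Here $\le$ between Weyl group elements is the Bruhat order on $W$, $u\cdot v$ is the Hecke product, and an expression such as $s_\alpha\cdot z^P_{d-\alpha^\vee}w_P$ means $s_\alpha\cdot(z^P_{d-\alpha^\vee}w_P)$.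
   Context: $R$ is the root system of a semisimple complex Lie group $G$, with positive roots $R^+$, simple roots $\Delta$, Weyl group $W$, and coroots $\alpha^\vee=2\alpha/(\alpha,\alpha)$. $P\supset B$ is a parabolic subgroup with Weyl group $W_P$ generated by $s_\beta$, $\beta\in\Delta_P\subset\Delta$; $R_P^+=R^+\cap\mathbb{Z}\Delta_P$; $w_P$ is the longest element of $W_P$; $W^P$ is the set of minimal length representatives of $W/W_P$. $\Delta^\vee,\Delta_P^\vee$ are the coroots of $\Delta,\Delta_P$. Order on $\mathbb{R}\Delta$: $x\ge y$ iff $x-y$ is a non-negative combination of simple roots (equivalently of simple coroots). $H_2(X)$ is identified with $\mathbb{Z}\Delta^\vee/\mathbb{Z}\Delta_P^\vee$, with basis the classes of $\beta^\vee$, $\beta\in\Delta\smallsetminus\Delta_P$; $d'\le d$ iff $d-d'$ has non-negative coefficients in this basis; $d$ is effective if $d\ge0$. In particular $H_2(G/B)=\mathbb{Z}\Delta^\vee$. Hecke product on $W$: $w\cdot s_\beta=ws_\beta$ if $\ell(ws_\beta)>\ell(w)$ and $w\cdot s_\beta=w$ otherwise ($\beta\in\Delta$); for $v=s_{\beta_1}\cdots s_{\beta_\ell}$ reduced, $w\cdot v=(\cdots(w\cdot s_{\beta_1})\cdots)\cdot s_{\beta_\ell}$. It is well defined and associative. Maximal roots of $d\in H_2(X)$: the maximal elements (for $\le$) of $\{\alpha\in R^+\smallsetminus R_P^+ : \alpha^\vee+\mathbb{Z}\Delta_P^\vee\le d\}$. A greedy decomposition of an effective $d$ is a sequence $(\alpha_1,\dots,\alpha_k)$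 of roots in $R^+\smallsetminus R_P^+$ such that $\alpha_1$ is a maximal root of $d$ and $(\alpha_2,\dots,\alpha_k)$ is a greedy decomposition of $d-\alpha_1^\vee\in H_2(X)$; the empty sequence is the only greedy decomposition of $0$. Greedy decompositions of $d$ are unique up to reordering, and $z_d^P\in W^P$ is the (well defined) unique element with $z_d^Pw_P=s_{\alpha_1}\cdot s_{\alpha_2}\cdot\ldots\cdot s_{\alpha_k}\cdot w_P$. For $P=B$ one writes $z_e=z_e^B$, so $z_e=s_{\alpha_1}\cdot\ldots\cdot s_{\alpha_k}$ for a greedy decomposition of $e\in\mathbb{Z}\Delta^\vee$. ''For all sufficiently large $e$ with $e+\mathbb{Z}\Delta_P^\vee=d$'' means: there is $e_0\in\mathbb{Z}\Delta^\vee$ with $e_0+\mathbb{Z}\Delta_P^\vee=d$ such that the assertion holds for all $e\ge e_0$ with $e+\mathbb{Z}\Delta_P^\vee=d$. *)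

(* Defs.v *)
From HB Require Import structures.
From mathcomp Require Import all_boot all_order all_algebra all_fingroup.
From mathcomp Require Import ring_quotient sesquilinear finmap boolp reals.

Set Implicit Arguments.
Unset Strict Implicit.
Unset Printing Implicit Defensive.

Import Order.TTheory GRing.Theory Num.Theory.
Local Open Scope ring_scope.
Local Open Scope quotient_scope.

Section Reflection.
Variables (R : realType) (V : vectType R) (form : {dot V for idfun}).

Definition coroot_vec (a : V) : V := (2 / form a a) *: a.

Definition reflection (a x : V) : V := x - form x (coroot_vec a) *: a.

End Reflection.

(* The root system of a semisimple complex Lie group with a choice of Borel
   subgroup: a reduced crystallographic root system in a Euclidean space with
   a base.  The ambient space V is the real span of the roots. *)
Record basedRootSystem (R : realType) (V : vectType R) := BasedRootSystem {
  rform : {dot V for idfun};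
  rootset : {fset V};
  roots_neq0 : 0 \notin rootset;
  roots_span : <<rootset>>%VS = fullv;
  roots_refl : forall a b, a \in rootset -> b \in rootset ->
    reflection rform a b \in rootset;
  roots_int : forall a b, a \in rootset -> b \in rootset ->
    exists m : int, rform b (coroot_vec rform a) = m%:~R;
  roots_reduced : forall (a : V) (c : R), a \in rootset -> c *: a \in rootset ->
    c = 1 \/ c = -1;
  simples : {set rootset};
  simples_free : free [seq fsval b | b in simples];
  simples_base : forall a : rootset, exists c : rootset -> nat,
    fsval a = \sum_(b in simples) fsval b *+ c b \/
    fsval a = - (\sum_(b in simples) fsval b *+ c b)
}.

Section WeylGroup.
Variables (R : realType) (V : vectType R) (Phi : basedRootSystem V).

Local Notation root := (rootset Phi).
Local Notation Delta := (simples Phi).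
Local Notation weylT := {perm rootset Phi}.

Definition coroot (a : root) : V := coroot_vec (rform Phi) (fsval a).

(* The order on the real span of Delta. *)
Definition root_le (x y : V) : Prop :=
  exists2 c : root -> R, (forall b, 0 <= c b) &
    y - x = \sum_(b in Delta) c b *: fsval b.

Definition int_span (f : root -> V) (A : {set root}) : {pred V} :=
  fun x => `[< exists c : root -> int, x = \sum_(b in A) f b *~ c b >].

Lemma int_span_zmod_closed f A : zmod_closed (int_span f A).
Proof.
split=> [|x y /asboolP[c ->] /asboolP[c' ->]]; apply/asboolP.
  by exists (fun=> 0); rewrite big1 // => b _; rewrite mulr0z.
exists (fun b => c b - c' b).
by rewrite -sumrB; apply: eq_bigr => b _; rewrite mulrzBr.
Qed.

Definition root_lattice (P : {set root}) := int_span (fun a => fsval a) P.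
Definition coroot_lattice (P : {set root}) := int_span coroot P.

HB.instance Definition _ P :=
  GRing.isZmodClosed.Build V (coroot_lattice P)
    (int_span_zmod_closed coroot P).

Definition is_positive (a : root) : Prop :=
  exists c : root -> nat, fsval a = \sum_(b in Delta) fsval b *+ c b.

(* Membership in R_P^+. *)
Definition is_positive_in (P : {set root}) (a : root) : Prop :=
  is_positive a /\ fsval a \in root_lattice P.

Fact reflectionK (a : V) : a != 0 -> involutive (reflection (rform Phi) a).
Proof.
move=> a0 x; rewrite /reflection linearBl /= linearZl_LR /=.
have -> : rform Phi a (coroot_vec (rform Phi) a) = 2.
  rewrite /coroot_vec linearZr_LR /= divfK // gt_eqF //.
  exact: neq0_dnorm_gt0.
set t := rform _ x _; have -> : t - t * 2 = - t.
  by rewrite mulr_natr mulr2n opprD addrA subrr add0r.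
by rewrite scaleNr opprK subrK.
Qed.

Definition reflection_root (a b : root) : root :=
  [` roots_refl (fsvalP a) (fsvalP b) ]%fset.

Fact reflection_root_inj a : injective (reflection_root a).
Proof.
have a0 : fsval a != 0.
  by apply: contraNneq (roots_neq0 Phi) => <-; exact: fsvalP.
move=> b c /(congr1 (fun r : root => fsval r)) /= /(can_inj (reflectionK a0)) bc.
exact: val_inj.
Qed.

(* The Weyl group acts faithfully on the roots, so it is realized as a group of
   permutations.  Products in {perm _} are composed from left to right, so a
   product of reflections s_a1 * ... * s_ak is the permutation induced by the
   inverse of the linear map s_a1 o ... o s_ak; this identification is a group
   isomorphism, and it fixes every reflection. *)
Definition refl (a : root) : weylT := perm (@reflection_root_inj a).

Definition weyl : {group weylT} := <<[set refl a | a : root]>>%G.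

Definition parabolic (P : {set root}) : {group weylT} :=
  <<[set refl b | b in P]>>%G.

Definition simple_refls : {set weylT} := [set refl b | b in Delta].

Fact wlength_ex (w : weylT) :
  exists n, (w \in <<simple_refls>>%g) ==> (w \in (simple_refls ^+ n)%g).
Proof.
case: (boolP (w \in _)) => [/gen_prodgP[n [c cS ->]]|_]; last by exists 0%N.
exists n => /=; elim: n c cS => [|n IH] c cS.
  by rewrite big_ord0 expg0 inE.
rewrite big_ord_recl expgS mem_mulg ?cS //.
by apply: IH => i; exact: cS.
Qed.

(* The least n such that w is a product of n simple reflections (w in W). *)
Definition wlength (w : weylT) : nat := ex_minn (wlength_ex w).

Definition bruhat_step (u v : weylT) : bool :=
  [exists a : root, (v == (u * refl a)%g) && (wlength u < wlength v)%N].

Definition bruhat (u v : weylT) : bool := connect bruhat_step u v.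

Definition reduced_word (w : weylT) : seq root :=
  odflt [::] (omap val [pick s : (wlength w).-tuple root |
    all (fun b => b \in Delta) s && (w == \prod_(b <- s) refl b)%g]).

Definition hecke_simple (w : weylT) (b : root) : weylT :=
  if (wlength w < wlength (w * refl b)%g)%N then (w * refl b)%g else w.

Definition hecke (u v : weylT) : weylT :=
  foldl hecke_simple u (reduced_word v).

Definition longest (P : {set root}) : weylT :=
  [arg max_(w > 1%g in parabolic P) wlength w].

Definition min_reps (P : {set root}) : {set weylT} :=
  [set w in weyl | [forall u in parabolic P, wlength w <= wlength (w * u)%g]%N].

(* H_2(G/P) is the image of the coroot lattice in this quotient of V; for
   P = set0 it is the coroot lattice itself. *)
Definition deg (P : {set root}) : zmodType := Quotient.quot (coroot_lattice P).

Definition deg_of (P : {set root}) (x : V) : deg P := \pi x.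

(* The nonnegative coefficients are integral since degrees lie in H_2(G/P). *)
Definition deg_le (P : {set root}) (d' d : deg P) : Prop :=
  exists c : root -> nat,
    d - d' = \sum_(b in Delta :\: P) deg_of P (coroot b) *+ c b.

Definition effective (P : {set root}) (d : deg P) : Prop := deg_le 0 d.

Definition below_deg (P : {set root}) (d : deg P) (a : root) : Prop :=
  [/\ is_positive a, ~ is_positive_in P a & deg_le (deg_of P (coroot a)) d].

Definition maximal_root (P : {set root}) (d : deg P) (a : root) : Prop :=
  below_deg d a /\
  forall b, below_deg d b -> root_le (fsval a) (fsval b) -> b = a.

Inductive greedy (P : {set root}) : deg P -> seq root -> Prop :=
| greedy_nil : greedy 0 [::]
| greedy_cons d a s : maximal_root d a ->
    greedy (d - deg_of P (coroot a)) s -> greedy d (a :: s).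

(* z_d^P, for effective d; the default value 1 is never used in that case. *)
Definition zdeg (P : {set root}) (d : deg P) : weylT :=
  odflt 1%g [pick z | (z \in min_reps P) &&
    `[< exists2 s, greedy d s & (z * longest P)%g =
          foldr (fun a w => hecke (refl a) w) (longest P) s >]].

(* The case P = B, where Z Delta^vee is H_2(G/B). *)
Definition degB_of (x : V) : deg set0 := deg_of set0 x.
Definition zB (e : V) : weylT := zdeg (degB_of e).

End WeylGroup.

Arguments degB_of {R V} Phi x.
Arguments zB {R V} Phi e.

(* Main.v *)
(* Write H(s) for the Hecke product of the reflections in a list s of positive
   roots.  The heart of the matter is the case P = B: among the lists whose
   coroots add up to at most e, the greedy ones have the largest H(s) for the
   Bruhat order.  Two members of a greedy list Hecke-commute, because an
   earlier one pairs nonnegatively with every simple root in the support of a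
   later one; hence, if e pairs positively with a simple root i, then H of a
   greedy list of e absorbs s_i on both sides.  Now argue by induction on e.
   Choose i with (e, i) > 0.  Any product of degree at most e is bounded by
   s_i . u . s_i with u a product of degree at most e - i^vee ([peels_step]),
   and u is bounded by H of any greedy list of e, since a maximal root a of e,
   or else s_i a, is a maximal root of e - i^vee ([dominates_sub_simple]).

   For general P, a greedy list for G/P followed by a greedy list for a large
   degree supported in P is a greedy list for G/B, which bounds every
   H(s) . w_P with s of degree at most d.  All four assertions are formal
   consequences of this bound. *)
From HB Require Import structures.
Require Import Defs.
From mathcomp Require Import all_boot all_order all_algebra all_fingroup.
From mathcomp Require Import ring_quotient sesquilinear finmap boolp reals ring lra.

Set Implicit Arguments.
Unset Strict Implicit.
Unset Printing Implicit Defensive.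

Import Order.TTheory GRing.Theory Num.Theory.
Local Open Scope ring_scope.

(** * Roots and coordinates on the base *)

(** The one step that is not formal is that s_i a is a maximal root of e - i^vee when a uses up the
    i-coordinate of e. Maximality compares coordinates on simple roots ([cf]), degrees compare
    coordinates on simple coroots ([ccf]), and the two disagree when root lengths differ. In the
    critical case a competitor b of s_i a has the larger root coordinate at i but not the larger
    coroot coordinate, so b is longer than s_i a, which is itself longer than i; three lengths in
    one component are impossible. Bounding by s_i . u . s_i and bounding by a greedy product are
    proved in one induction: to treat a list headed by b, its tail is first replaced by a greedy
    list of e - b^vee, from which an s_i may again have to be extracted. The bound holds for every
    greedy list, so two greedy lists of one degree bound each other and have equal products; this
    yields the equality in (c). The degree supported in P has to be large so that a word l in P with
    H(l) = w_P fits into it. *)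

Lemma corootE (R : realType) (V : vectType R) (Phi : basedRootSystem V)
    (a : rootset Phi) :
  coroot a = (2 / rform Phi (fsval a) (fsval a)) *: fsval a.
Proof. by []. Qed.

Lemma reflection_rootE (R : realType) (V : vectType R) (Phi : basedRootSystem V)
    (a b : rootset Phi) :
  fsval (reflection_root a b) =
  fsval b - rform Phi (fsval b) (coroot a) *: fsval a.
Proof. by []. Qed.

#[global] Opaque coroot reflection_root.

Section Roots.
Variables (R : realType) (V : vectType R) (Phi : basedRootSystem V).

Local Notation root := (rootset Phi).
Local Notation Delta := (simples Phi).
Local Notation "''[' u , v ]" := (rform Phi u v) : ring_scope.
Local Notation val a := (fsval a).

Implicit Types (a b c i : root) (x y : V).

Lemma dotC x y : '[x, y] = '[y, x].
Proof. by rewrite hermC expr0 mul1r. Qed.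

Lemma dotDl x y z : '[x + y, z] = '[x, z] + '[y, z].
Proof. by rewrite linearDl. Qed.
Lemma dotBl x y z : '[x - y, z] = '[x, z] - '[y, z].
Proof. by rewrite linearBl. Qed.
Lemma dotNl x z : '[- x, z] = - '[x, z].
Proof. by rewrite linearNl. Qed.
Lemma dotZl k x z : '[k *: x, z] = k * '[x, z].
Proof. by rewrite linearZl_LR. Qed.
Lemma dotDr x y z : '[z, x + y] = '[z, x] + '[z, y].
Proof. by rewrite !(dotC z) dotDl. Qed.
Lemma dotBr x y z : '[z, x - y] = '[z, x] - '[z, y].
Proof. by rewrite !(dotC z) dotBl. Qed.
Lemma dotNr x z : '[z, - x] = - '[z, x].
Proof. by rewrite !(dotC z) dotNl. Qed.
Lemma dotZr k x z : '[z, k *: x] = k * '[z, x].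
Proof. by rewrite !(dotC z) dotZl. Qed.
Lemma dot_suml I (r : seq I) (P : pred I) (F : I -> V) z :
  '[\sum_(j <- r | P j) F j, z] = \sum_(j <- r | P j) '[F j, z].
Proof. by rewrite linear_sumlz. Qed.

Definition dotE := (dotDl, dotBl, dotNl, dotZl, dotDr, dotBr, dotNr, dotZr).

Lemma root_neq0 a : val a != 0.
Proof.
by apply: contraNneq (roots_neq0 Phi) => <-; exact: fsvalP.
Qed.

Lemma dot_gt0 x : x != 0 -> 0 < '[x, x].
Proof. exact: neq0_dnorm_gt0. Qed.

Lemma dot_eq0 x : '[x, x] = 0 -> x = 0.
Proof. by move=> h; apply/eqP; apply: contraTT isT => /dot_gt0; rewrite h ltxx. Qed.

Lemma sqn_gt0 a : 0 < '[val a, val a].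
Proof. exact/dot_gt0/root_neq0. Qed.

Lemma coroot_scale_gt0 a : 0 < 2 / '[val a, val a].
Proof. by rewrite divr_gt0 ?ltr0n ?sqn_gt0. Qed.

Lemma dot_coroot_gt0 a x : (0 < '[x, coroot a]) = (0 < '[x, val a]).
Proof. by rewrite corootE dotE pmulr_rgt0 ?coroot_scale_gt0. Qed.

Lemma dot_coroot_eq0 a x : ('[x, coroot a] == 0) = ('[x, val a] == 0).
Proof. by rewrite corootE dotE mulf_eq0 gt_eqF ?coroot_scale_gt0. Qed.

Lemma dot_coroot_lt0 a x : ('[x, coroot a] < 0) = ('[x, val a] < 0).
Proof. by rewrite corootE dotE pmulr_rlt0 ?coroot_scale_gt0. Qed.

Lemma dot_rootK a : '[val a, coroot a] = 2.
Proof. by rewrite corootE dotE divfK // gt_eqF ?sqn_gt0. Qed.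

Lemma dot_rootKC a : '[coroot a, val a] = 2.
Proof. by rewrite dotC dot_rootK. Qed.

Lemma dot_coroot_sqn a x : '[x, coroot a] * '[val a, val a] = 2 * '[x, val a].
Proof. by rewrite corootE dotE; field; rewrite gt_eqF ?sqn_gt0. Qed.

Lemma dot_int a b : exists m : int, '[val b, coroot a] = m%:~R.
Proof. by apply: roots_int; exact: fsvalP. Qed.

Lemma root_inj a b : val a = val b -> a = b.
Proof. exact: val_inj. Qed.

Lemma reflection_rootK a : involutive (reflection_root a).
Proof. move=> b; apply: root_inj; rewrite !reflection_rootE dotBl dotZl dot_rootK.
rewrite -addrA -opprD -scalerDl; set k := '[_, _].
by have -> : k + (k - k * 2) = 0 by [ring]; rewrite scale0r subr0. Qed.

Definition opp_root a : root := reflection_root a a.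

Lemma opp_rootE a : val (opp_root a) = - val a.
Proof. by rewrite reflection_rootE dot_rootK scaler_nat mulr2n opprD addNKr. Qed.

Lemma opp_rootK : involutive opp_root.
Proof. by move=> a; apply: root_inj; rewrite !opp_rootE opprK. Qed.

Lemma reflection_dot a x y :
  '[x - '[x, coroot a] *: val a, y - '[y, coroot a] *: val a] = '[x, y].
Proof.
rewrite corootE !dotE !(dotC (val a)).
have := sqn_gt0 a; set n := '[val a, val a] => n0.
by field; rewrite gt_eqF.
Qed.

Lemma sqn_reflection a b :
  '[val (reflection_root a b), val (reflection_root a b)] = '[val b, val b].
Proof. by rewrite !reflection_rootE reflection_dot. Qed.

Lemma coroot_reflection a b :
  coroot (reflection_root a b) = coroot b - '[coroot b, val a] *: coroot a.
Proof.
rewrite [LHS]corootE sqn_reflection reflection_rootE scalerBr -corootE.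
congr (_ - _); rewrite scalerA !corootE !scalerA; congr (_ *: _).
by rewrite !dotE; ring.
Qed.

Lemma reflection_oppl a b : reflection_root (opp_root a) b = reflection_root a b.
Proof.
apply: root_inj; rewrite reflection_rootE corootE opp_rootE reflection_rootE corootE !dotE.
by rewrite opprK scalerN mulrN scaleNr opprK.
Qed.

(** The vector x minus its projection on the line of y is nonzero by hypothesis, so its squared norm
    is positive; this gives the strict inequality. *)
Lemma cauchy_schwarz x y : y != 0 -> x != ('[x, y] / '[y, y]) *: y ->
  '[x, y] ^+ 2 < '[x, x] * '[y, y].
Proof.
move=> /dot_gt0 y0; rewrite -subr_eq0 => /dot_gt0; rewrite !dotE (dotC y x).
set n := '[y, y] in y0 *; set p := '[x, y]; set q := '[x, x] => h.
have -> : q * n = p ^+ 2 + n * (q - p / n * p - p / n * (p - p / n * n)).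
  by field; rewrite gt_eqF.
by rewrite ltrDl mulr_gt0.
Qed.

(** Reducedness leaves a = b and a = -b as the only proportional pairs, so the strict Cauchy-Schwarz
    inequality applies. *)
Lemma cartan_lt4 a b : a != b -> a != opp_root b ->
  '[val a, coroot b] * '[val b, coroot a] < 4.
Proof.
move=> ab aNb; rewrite !corootE !dotE (dotC (val b)).
have a0 := sqn_gt0 a; have b0 := sqn_gt0 b.
have : '[val a, val b] ^+ 2 < '[val a, val a] * '[val b, val b].
  apply: cauchy_schwarz; first exact: root_neq0.
  apply/eqP => E; have Ea : ('[val a, val b] / '[val b, val b]) *: val b \in root.
    by rewrite -E fsvalP.
  have [k1|k1] := roots_reduced (fsvalP b) Ea; rewrite k1 in E.
    by case/eqP: ab; apply: root_inj; rewrite E scale1r.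
  by case/eqP: aNb; apply: root_inj; rewrite opp_rootE E scaleN1r.
set p := '[val a, val b]; set m := '[val a, val a] in a0 *.
set n := '[val b, val b] in b0 * => h.
have -> : 2 / n * p * (2 / m * p) = 4 * (p ^+ 2 / (m * n)).
  by field; rewrite !gt_eqF.
by rewrite gtr_pMr ?ltr0n // ltr_pdivrMr ?mul1r // mulr_gt0.
Qed.

Lemma simple_coef_ex x : exists k : root -> R, x = \sum_(b in Delta) k b *: val b.
Proof.
have : x \in <<rootset Phi>>%VS by rewrite roots_span memvf.
have sub : (<<rootset Phi>> <= <<[seq fsval b | b in Delta]>>)%VS.
  apply/span_subvP => v vr; have [k] := simples_base [` vr]%fset.
  have memS : \sum_(b in Delta) fsval b *+ k b \in <<[seq fsval b | b in Delta]>>%VS.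
    by apply: memv_suml => b bD; rewrite -scaler_nat; apply/memvZ/memv_span/image_f.
  by case=> /= ->; rewrite ?memvN.
move=> /(subvP sub); rewrite span_def big_image => /memv_sumP[u uP ->].
have /choice [k kP] : forall b, exists k : R, b \in Delta -> u b = k *: val b.
  move=> b; case: (boolP (b \in Delta)) => [/uP /vlineP[k ->]|_]; last by exists 0.
  by exists k.
by exists k; apply: eq_bigr => b /kP.
Qed.

Lemma simple_coef_uniq (k l : root -> R) :
  \sum_(b in Delta) k b *: val b = \sum_(b in Delta) l b *: val b ->
  {in Delta, k =1 l}.
Proof.
move=> /eqP; rewrite -subr_eq0 -sumrB => /eqP E b bD.
have := simples_free Phi; set X := image_mem _ _ => /(freeP (X := in_tuple X)).
have sX : size X = #|Delta| by rewrite size_image.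
pose c (j : 'I_(size X)) := k (enum_val (cast_ord sX j)) - l (enum_val (cast_ord sX j)).
move=> /(_ c) h; apply/eqP; rewrite -subr_eq0; apply/eqP.
have <- : c (cast_ord (esym sX) (enum_rank_in bD b)) = k b - l b.
  by rewrite /c cast_ordKV enum_rankK_in.
apply: h; rewrite -[RHS]E (reindex_onto (enum_val (A := Delta)) (enum_rank_in bD)) /=; last first.
  by move=> i iD; rewrite enum_rankK_in.
rewrite (reindex (cast_ord sX)) /=; last first.
  by exists (cast_ord (esym sX)) => i _; rewrite ?cast_ordK ?cast_ordKV.
apply: eq_big => [i|i _]; first by rewrite enum_valP enum_valK_in eqxx.
by rewrite -scalerBl /c -(nth_image 0 (fun b : root => val b)).
Qed.

(* Junk value 0 when b is not simple. *)
Definition cf b x : R := if b \in Delta then projT1 (cid (simple_coef_ex x)) b else 0.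

Lemma cf_sum x : x = \sum_(b in Delta) cf b x *: val b.
Proof.
rewrite [LHS](projT2 (cid (simple_coef_ex x))).
by apply: eq_bigr => b bD; rewrite /cf bD.
Qed.

Lemma cfP x (k : root -> R) :
  x = \sum_(b in Delta) k b *: val b -> forall b, b \in Delta -> cf b x = k b.
Proof. by rewrite {1}[x]cf_sum; exact: simple_coef_uniq. Qed.

Lemma cf_out b x : b \notin Delta -> cf b x = 0.
Proof. by rewrite /cf => /negbTE->. Qed.

Fact cf_linear b : linear (cf b : V -> R^o).
Proof.
move=> k x y; case: (boolP (b \in Delta)) => [bD|bD]; last first.
  by rewrite !cf_out // scaler0 addr0.
apply: (@cfP _ (fun b => k * cf b x + cf b y)) bD.
rewrite {1}[x]cf_sum {1}[y]cf_sum scaler_sumr -big_split; apply: eq_bigr => c _ /=.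
by rewrite scalerA scalerDl.
Qed.

HB.instance Definition _ b := GRing.isLinear.Build R V R^o _ (cf b) (cf_linear b).

Lemma cfZ b k x : cf b (k *: x) = k * cf b x.
Proof. exact: (linearZ_LR (cf b)). Qed.

Lemma cfD b x y : cf b (x + y) = cf b x + cf b y.
Proof. exact: raddfD. Qed.

Lemma cfB b x y : cf b (x - y) = cf b x - cf b y.
Proof. exact: raddfB. Qed.

Lemma cf_simple b c : b \in Delta -> c \in Delta -> cf b (val c) = (b == c)%:R.
Proof.
move=> bD cD; apply: (@cfP _ (fun b => (b == c)%:R)) => //.
rewrite (bigD1 c) //= eqxx scale1r big1 ?addr0 // => d /andP[_ /negbTE->].
by rewrite scale0r.
Qed.

Lemma cf_inj x y : {in Delta, forall b, cf b x = cf b y} -> x = y.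
Proof.
by move=> h; rewrite [x]cf_sum [y]cf_sum; apply: eq_bigr => b /h->.
Qed.

Lemma dot_cf x y : '[x, y] = \sum_(b in Delta) cf b x * '[val b, y].
Proof. by rewrite {1}[x]cf_sum dot_suml; apply: eq_bigr => b _; rewrite dotE. Qed.

(** * Positive roots *)

Definition pos a : bool := [forall b in Delta, 0 <= cf b (val a)].

Lemma posP a : reflect {in Delta, forall b, 0 <= cf b (val a)} (pos a).
Proof. by apply: (iffP forall_inP). Qed.

Lemma pos_cf a b : pos a -> 0 <= cf b (val a).
Proof.
by move=> /posP pa; case: (boolP (b \in Delta)) => [/pa|/cf_out->].
Qed.

Lemma root_cf a : exists k : root -> nat,
  {in Delta, forall b, cf b (val a) = (k b)%:R} \/
  {in Delta, forall b, cf b (val a) = - (k b)%:R}.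
Proof.
have [k [E|E]] := simples_base a; exists k; [left|right]; apply: cfP.
  by rewrite {1}E; apply: eq_bigr => b _; rewrite scaler_nat.
by rewrite {1}E -sumrN; apply: eq_bigr => b _; rewrite scaleNr scaler_nat.
Qed.

Lemma pos_cf_nat a b : pos a -> exists k : nat, cf b (val a) = k%:R.
Proof.
case: (boolP (b \in Delta)) => [bD pa|bD _]; last by exists 0%N; rewrite cf_out.
have [k [->//|E]] := root_cf a; first by exists (k b).
exists 0%N; apply/eqP; have := pos_cf b pa.
by rewrite E // oppr_ge0 eqr_oppLR oppr0 eq_le ler0n andbT.
Qed.

Lemma is_positiveP a : is_positive a <-> pos a.
Proof.
split=> [[k E]|pa].
  apply/posP => b bD; rewrite (@cfP _ (fun b => (k b)%:R)) ?ler0n // E.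
  by apply: eq_bigr => c _; rewrite scaler_nat.
have /choice[k kP] b : exists k : nat, cf b (val a) = k%:R by exact: pos_cf_nat.
exists k; rewrite {1}[val a]cf_sum; apply: eq_bigr => b bD.
by rewrite kP scaler_nat.
Qed.

Lemma cf_opp a b : cf b (val (opp_root a)) = - cf b (val a).
Proof. by rewrite opp_rootE raddfN. Qed.

Lemma root_cf_neq0 a : exists2 b, b \in Delta & cf b (val a) != 0.
Proof.
case: (pselect (exists2 b, b \in Delta & cf b (val a) != 0)) => // h.
case/eqP: (root_neq0 a); apply: cf_inj => b bD; rewrite raddf0.
by apply/eqP; apply: contra_notT h => ?; exists b.
Qed.

Lemma pos_oppE a : pos (opp_root a) = ~~ pos a.
Proof.
have [k [E|E]] := root_cf a.
  have pa : pos a by apply/posP => b /E->; rewrite ler0n.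
  rewrite pa; apply/negbTE/negP => pNa; have [b bD /eqP[]] := root_cf_neq0 a.
  by apply/eqP; rewrite eq_le pos_cf // andbT -oppr_ge0 -cf_opp pos_cf.
have pNa : pos (opp_root a) by apply/posP => b bD; rewrite cf_opp E ?opprK ?ler0n.
rewrite pNa; apply/esym/negP => pa; have [b bD /eqP[]] := root_cf_neq0 a.
by apply/eqP; rewrite eq_le pos_cf // andbT -oppr_ge0 -cf_opp pos_cf.
Qed.

Lemma pos_gt0 a : pos a -> exists2 b, b \in Delta & 0 < cf b (val a).
Proof.
by move=> pa; have [b bD b0] := root_cf_neq0 a; exists b; rewrite // lt0r b0 pos_cf.
Qed.

Lemma cf_gt0_pos a b : 0 < cf b (val a) -> pos a.
Proof.
move=> h; apply: contraTT h; rewrite -pos_oppE => /(pos_cf b).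
by rewrite cf_opp oppr_ge0 leNgt.
Qed.

Lemma cf_lt0_neg a b : cf b (val a) < 0 -> pos a = false.
Proof. by move=> h; apply/negP => /(pos_cf b); rewrite leNgt h. Qed.

Lemma pos_simple i : i \in Delta -> pos i.
Proof. by move=> iD; apply: (@cf_gt0_pos _ i); rewrite cf_simple // eqxx ltr01. Qed.

(* Otherwise a would be a multiple of i, but the root system is reduced. *)
Lemma pos_neq_simple i a : i \in Delta -> pos a -> a != i ->
  exists2 b, b \in Delta & (b != i) && (0 < cf b (val a)).
Proof.
move=> iD pa ai.
case: (pselect (exists2 b, b \in Delta & (b != i) && (0 < cf b (val a)))) => // h.
have E : val a = cf i (val a) *: val i.
  apply: cf_inj => b bD; rewrite cfZ (cf_simple bD iD); have [->|bi] := eqVneq b i.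
    by rewrite mulr1.
  rewrite mulr0; apply/eqP; apply: contra_notT h => b0; exists b => //.
  by rewrite bi lt0r b0 pos_cf.
have Ea := fsvalP a; rewrite E in Ea.
have [k1|k1] := roots_reduced (fsvalP i) Ea; rewrite k1 in E.
  by case/eqP: ai; apply: root_inj; rewrite E scale1r.
by have := pos_cf i pa; rewrite k1 ler0N1.
Qed.

Lemma cf_reflection_simple i a b : i \in Delta -> b != i ->
  cf b (val (reflection_root i a)) = cf b (val a).
Proof.
move=> iD bi; rewrite reflection_rootE raddfB /= cfZ.
case: (boolP (b \in Delta)) => bD; last by rewrite !cf_out // mulr0 subr0.
by rewrite (cf_simple bD iD) (negbTE bi) mulr0 subr0.
Qed.

Lemma pos_reflection_simple i a : i \in Delta -> pos a -> a != i ->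
  pos (reflection_root i a).
Proof.
move=> iD pa /(pos_neq_simple iD pa)[b bD /andP[bi b0]].
by apply: (@cf_gt0_pos _ b); rewrite cf_reflection_simple.
Qed.

(** Expanding the first argument, (x, x) is the sum of the [cf b x] times (b, x); as (x, x) > 0,
    some term is positive. *)
Lemma ex_dot_gt0 x : x != 0 -> {in Delta, forall b, 0 <= cf b x} ->
  exists2 i, i \in Delta & (0 < cf i x) && (0 < '[x, val i]).
Proof.
move=> /dot_gt0; rewrite dot_cf => x0 xp.
case: (pselect (exists2 i, i \in Delta & (0 < cf i x) && (0 < '[x, val i]))) => // h.
move: x0; rewrite ltNge sumr_le0 // => b bD; have := xp b bD.
rewrite le0r => /orP[/eqP->|b0]; first by rewrite mul0r.
rewrite pmulr_rle0 // leNgt dotC; apply: contra_notN h => h.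
by exists b; rewrite // b0.
Qed.

Lemma pos_ex_dot_gt0 a : pos a ->
  exists2 i, i \in Delta & (0 < cf i (val a)) && (0 < '[val a, val i]).
Proof. by move=> pa; apply: ex_dot_gt0 (root_neq0 a) _ => b _; exact: pos_cf. Qed.

End Roots.

Arguments pos {R V Phi} a.
Arguments dotC {R V Phi} x y.
Arguments dot_coroot_sqn {R V Phi} a x.

(** * Coroots, degrees and greedy decompositions *)

Section Degrees.
Variables (R : realType) (V : vectType R) (Phi : basedRootSystem V).

Local Notation root := (rootset Phi).
Local Notation Delta := (simples Phi).
Local Notation "''[' u , v ]" := (rform Phi u v) : ring_scope.
Local Notation val a := (fsval a).

Implicit Types (a b c i : root) (x y : V) (P : {set root}).

Lemma dot_coroot_int a b : '[val b, coroot a] \is a Num.int.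
Proof. by have [m ->] := dot_int a b; rewrite rpred_int_num. Qed.

Lemma dot_coroot_intC a b : '[coroot b, val a] \is a Num.int.
Proof. by rewrite dotC dot_coroot_int. Qed.

Lemma int_gt0_ge1 (k : R) : k \is a Num.int -> 0 < k -> 1 <= k.
Proof. by move=> /intrP[m ->]; rewrite ltr0z ler1z gtz0_ge1. Qed.

Lemma int_eq1_or_ge2 (k : R) : k \is a Num.int -> 0 < k -> k = 1 \/ 2 <= k.
Proof.
move=> kZ /(int_gt0_ge1 kZ); rewrite le_eqVlt => /orP[/eqP<-|]; first by left.
rewrite -subr_gt0 => /(int_gt0_ge1 (rpredB kZ (rpred1 _))) h; right; lra.
Qed.

(** Every positive root is reached from a simple one by simple reflections that each raise it. Read
    downwards, a non-simple a has a simple i with (a, i) > 0, and s_i a is positive with coordinate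
    sum smaller by the Cartan integer (a, i^vee), which is at least 1. *)
Lemma pos_ind (Q : root -> Prop) :
  (forall i, i \in Delta -> Q i) ->
  (forall i a, i \in Delta -> pos a -> a != i -> '[val a, val i] < 0 -> Q a ->
    0 < cf i (val (reflection_root i a)) -> Q (reflection_root i a)) ->
  forall a, pos a -> Q a.
Proof.
move=> Qs Qr; pose h a : R := \sum_(b in Delta) cf b (val a).
suff H n : forall a, pos a -> h a < n%:R -> Q a.
  move=> a pa; have [k [E|E]] := root_cf a; last first.
    apply: (H 1%N) => //; apply: le_lt_trans ltr01.
    by apply: sumr_le0 => b /E->; rewrite oppr_le0.
  apply: (H (\sum_(b in Delta) k b).+1) => //.
  rewrite /h (eq_bigr (fun b => (k b)%:R)) => [|b /E//].
  by rewrite -natr_sum ltr_nat.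
elim: n => [|n IH] a pa hn.
  by move: hn; rewrite ltNge sumr_ge0 // => b _; exact: pos_cf.
have [i iD /andP[ci di]] := pos_ex_dot_gt0 pa.
have [->|ai] := eqVneq a i; first exact: Qs.
have pb := pos_reflection_simple iD pa ai; rewrite -(reflection_rootK i a).
apply: Qr => //; rewrite ?reflection_rootK //.
- apply: contraNneq ai => /(congr1 (reflection_root i)); rewrite reflection_rootK => E.
  have : pos a = ~~ pos i by rewrite E pos_oppE.
  by rewrite pa pos_simple.
- by rewrite reflection_rootE dotBl dotZl dot_coroot_sqn; lra.
apply: IH => //; move: hn; have -> : h a = h (reflection_root i a) + '[val a, coroot i].
  rewrite /h (bigD1 i iD) [in RHS](bigD1 i iD).
  rewrite (eq_bigr (fun b => cf b (val (reflection_root i a)))) => [|b /andP[_ bi]].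
    rewrite reflection_rootE raddfB /= cfZ (cf_simple iD iD) eqxx mulr1.
    by rewrite [RHS]addrAC subrK.
  by rewrite cf_reflection_simple.
have : 1 <= '[val a, coroot i] by rewrite int_gt0_ge1 ?dot_coroot_int ?dot_coroot_gt0.
by rewrite -natr1; lra.
Qed.

(** Coordinate of x on the simple coroot of b: since b^vee = (2 / (b, b)) b, it is the root
    coordinate rescaled. *)
Definition ccf b x : R := cf b x * ('[val b, val b] / 2).

Fact ccf_linear b : linear (ccf b : V -> R^o).
Proof. by move=> k x y; rewrite /ccf raddfD /= cfZ mulrDl -mulrA. Qed.

HB.instance Definition _ b := GRing.isLinear.Build R V R^o _ (ccf b) (ccf_linear b).

Lemma ccfZ b k x : ccf b (k *: x) = k * ccf b x.
Proof. exact: (linearZ_LR (ccf b)). Qed.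

Lemma ccfD b x y : ccf b (x + y) = ccf b x + ccf b y.
Proof. exact: raddfD. Qed.

Lemma ccfB b x y : ccf b (x - y) = ccf b x - ccf b y.
Proof. exact: raddfB. Qed.

Lemma ccfN b x : ccf b (- x) = - ccf b x.
Proof. exact: raddfN. Qed.

Lemma ccf_out b x : b \notin Delta -> ccf b x = 0.
Proof. by move=> bD; rewrite /ccf cf_out // mul0r. Qed.

Lemma ccf_simple b c : b \in Delta -> c \in Delta -> ccf b (coroot c) = (b == c)%:R.
Proof.
move=> bD cD; rewrite /ccf corootE cfZ cf_simple //; case: eqVneq => [->|_].
  by rewrite mulr1 mulr1n; field; rewrite gt_eqF ?sqn_gt0.
by rewrite mulr0 mul0r.
Qed.

Lemma ccf_scale_gt0 b : 0 < '[val b, val b] / 2.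
Proof. by rewrite divr_gt0 ?ltr0n ?sqn_gt0. Qed.

Lemma ccf_gt0 b x : (0 < ccf b x) = (0 < cf b x).
Proof. by rewrite pmulr_lgt0 ?ccf_scale_gt0. Qed.

Lemma ccf_eq0 b x : (ccf b x == 0) = (cf b x == 0).
Proof. by rewrite mulf_eq0 (gt_eqF (ccf_scale_gt0 b)) orbF. Qed.

Lemma ccf_ge0 b x : (0 <= ccf b x) = (0 <= cf b x).
Proof. by rewrite pmulr_lge0 ?ccf_scale_gt0. Qed.

Lemma ccf_sum x : x = \sum_(b in Delta) ccf b x *: coroot b.
Proof.
rewrite {1}(cf_sum Phi x); apply: eq_bigr => b bD; rewrite corootE scalerA; congr (_ *: _).
by rewrite /ccf; field; rewrite gt_eqF ?sqn_gt0.
Qed.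

Lemma ccf_inj x y : (forall b, ccf b x = ccf b y) -> x = y.
Proof. by move=> h; rewrite [x]ccf_sum [y]ccf_sum; apply: eq_bigr => b _; rewrite h. Qed.

(** Along [pos_ind], each raising reflection adds to the coroot a nonnegative integer multiple of a
    simple coroot. *)
Lemma ccf_coroot_nat a b : pos a -> ccf b (coroot a) \is a Num.nat.
Proof.
move=> pa; case: (boolP (b \in Delta)) => bD; last by rewrite ccf_out.
move: a pa; apply: pos_ind => [i iD|i a iD _ _ ai IH _].
  by rewrite ccf_simple // rpred_nat_num.
have kN : - '[coroot a, val i] \is a Num.nat.
  rewrite natrEint rpredN dot_coroot_intC oppr_ge0 ltW //.
  by rewrite dotC dot_coroot_lt0 dotC.
rewrite coroot_reflection -scaleNr raddfD /= (ccfZ b (- _)) (ccf_simple bD iD).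
by apply: rpredD IH _; apply: rpredM kN _; exact: rpred_nat_num.
Qed.

(* A degree is represented by a vector x; [eff P x] says that the class of x
   modulo the coroots of P is effective. *)
Definition eff P x : Prop := forall b, b \notin P -> ccf b x \is a Num.nat.

Lemma eff_zero P : eff P 0.
Proof. by move=> b _; rewrite raddf0. Qed.

Lemma effD P x y : eff P x -> eff P y -> eff P (x + y).
Proof. by move=> ex ey b bP; rewrite raddfD /= rpredD ?ex ?ey. Qed.

Lemma eff_coroot P a : pos a -> eff P (coroot a).
Proof. by move=> pa b _; exact: ccf_coroot_nat. Qed.

Lemma eff_sum P (s : seq root) : all pos s -> eff P (\sum_(a <- s) coroot a).
Proof.
elim: s => [_|a s IH /andP[pa ps]]; first by rewrite big_nil; exact: eff_zero.
by rewrite big_cons; apply: effD; [exact: eff_coroot | exact: IH].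
Qed.

Lemma eff_scale P (k : nat) x : eff P x -> eff P (k%:R *: x).
Proof.
by move=> ex b bP; rewrite ccfZ; apply: rpredM (ex b bP); exact: rpred_nat_num.
Qed.

Lemma eff_cf_ge0 P x b : eff P x -> b \notin P -> 0 <= cf b x.
Proof. by move=> ex bP; rewrite -ccf_ge0 natr_ge0 ?ex. Qed.

Lemma eff_sub_simple P x i : eff P x -> i \in Delta -> 0 < cf i x ->
  eff P (x - coroot i).
Proof.
move=> ex iD xi b bP; rewrite raddfB /=; case: (boolP (b \in Delta)) => bD; last first.
  by rewrite !ccf_out // subr0.
rewrite (ccf_simple bD iD); have [bi|_] := eqVneq b i; last by rewrite subr0 ex.
have xZ : ccf b x \is a Num.int by exact/intr_nat/ex.
rewrite natrEint mulr1n; apply/andP; split; first exact: rpredB xZ (rpred1 _).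
by rewrite subr_ge0 int_gt0_ge1 // bi ccf_gt0.
Qed.

Lemma eff_dot_int x b : eff set0 x -> '[x, val b] \is a Num.int.
Proof.
move=> ex; rewrite [x]ccf_sum dot_suml rpred_sum // => c _.
rewrite dotZl; apply: rpredM; last exact: dot_coroot_intC.
by apply/intr_nat/ex; rewrite inE.
Qed.

(* One of the two Cartan integers is -1; the corresponding reflection gives d. *)
Lemma coroot_addition a i : '[val a, val i] < 0 -> a != opp_root i ->
  exists d : root, [/\ coroot d = coroot a + coroot i &
    exists2 k, 1 <= k & val d = k *: val a - '[val a, coroot i] *: val i].
Proof.
move=> ai aNi; have anei : a != i.
  by apply: contraTneq ai => ->; rewrite -leNgt ltW ?sqn_gt0.
have h := cartan_lt4 anei aNi.
have p1 : '[val a, coroot i] < 0 by rewrite dot_coroot_lt0.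
have q1 : '[val i, coroot a] < 0 by rewrite dot_coroot_lt0 dotC.
have pZ : - '[val a, coroot i] \is a Num.int by rewrite rpredN dot_coroot_int.
have qZ : - '[val i, coroot a] \is a Num.int by rewrite rpredN dot_coroot_int.
have /(int_eq1_or_ge2 pZ) p : 0 < - '[val a, coroot i] by rewrite oppr_gt0.
have /(int_eq1_or_ge2 qZ) q : 0 < - '[val i, coroot a] by rewrite oppr_gt0.
case: q => q; [exists (reflection_root i a)|exists (reflection_root a i)]; split.
- by rewrite coroot_reflection dotC -scaleNr q scale1r.
- by exists 1; rewrite ?scale1r.
(* If (i, a^vee) is at most -2, the bound 4 on the product forces (a, i^vee) = -1, and s_a i is the
   root sought. *)
- rewrite coroot_reflection dotC -scaleNr; case: p => [->|p]; last by exfalso; nra.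
  by rewrite scale1r addrC.
exists (- '[val i, coroot a]); first lra.
rewrite reflection_rootE scaleNr -scaleNr; case: p => [E|p]; last by exfalso; nra.
by rewrite -[in RHS]scaleNr E scale1r addrC.
Qed.

(** * Maximal roots and greedy lists in coordinates *)

Definition outside P a : bool := [exists b, (b \notin P) && (0 < cf b (val a))].

Lemma outside0 a : pos a -> outside set0 a.
Proof. by move=> /pos_gt0[b _ b0]; apply/existsP; exists b; rewrite inE. Qed.

(** A competitor b inherits [outside P] from a, which it dominates. *)
Definition maxr P x a : Prop :=
  [/\ pos a, outside P a, eff P (x - coroot a) &
    forall b, pos b -> eff P (x - coroot b) ->
      (forall c, cf c (val a) <= cf c (val b)) -> b = a].

(** Follows a vector x rather than its class: only coordinates outside P are tested, and the list
    ends when they all vanish. *)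
Fixpoint vgreedy P x (s : seq root) : Prop :=
  if s is a :: s' then maxr P x a /\ vgreedy P (x - coroot a) s'
  else forall b, b \notin P -> ccf b x = 0.

Lemma vgreedy_pos P x s : vgreedy P x s -> all pos s.
Proof. by elim: s x => //= a s IH x [[-> _ _ _] /IH]. Qed.

Definition height P x : R := \sum_(b | b \notin P) ccf b x.

Lemma heightB P x y : height P (x - y) = height P x - height P y.
Proof. by rewrite /height -sumrB; apply: eq_bigr => b _; rewrite raddfB. Qed.

Lemma height_ge0 P x : eff P x -> 0 <= height P x.
Proof. by move=> ex; apply: sumr_ge0 => b bP; rewrite natr_ge0 ?ex. Qed.

Lemma height_coroot_ge1 P a : pos a -> outside P a -> 1 <= height P (coroot a).
Proof.
move=> pa /existsP[b /andP[bP b0]]; rewrite /height (bigD1 b) //=.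
have b1 : 1 <= ccf b (coroot a).
  apply: int_gt0_ge1; first by rewrite intr_nat ?ccf_coroot_nat.
  by rewrite ccf_gt0 corootE cfZ mulr_gt0 ?coroot_scale_gt0.
rewrite -[1]addr0 lerD // sumr_ge0 // => c _.
by rewrite natr_ge0 ?ccf_coroot_nat.
Qed.

Lemma eff_height_ltn P x : eff P x -> exists n : nat, height P x < n%:R.
Proof.
move=> ex; have : height P x \is a Num.nat by apply: rpred_sum => b; exact: ex.
by move=> /natrP[n ->]; exists n.+1; rewrite ltr_nat.
Qed.

Lemma eff_ind P (Q : V -> Prop) :
  (forall x, eff P x ->
    (forall y, eff P y -> height P y + 1 <= height P x -> Q y) -> Q x) ->
  forall x, eff P x -> Q x.
Proof.
move=> IH x ex; have [n] := eff_height_ltn ex; elim: n x ex => [|n IHn] x ex hx.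
  by move: hx; rewrite ltNge height_ge0.
apply: IH => // y ey hy; apply: IHn => //.
by move: hx; rewrite -natr1; lra.
Qed.

Lemma eff_subr P x a : pos a -> eff P (x - coroot a) -> eff P x.
Proof. by move=> pa /effD /(_ (@eff_coroot P a pa)); rewrite subrK. Qed.

(** The root b only shows that candidates exist; a candidate with the largest coordinate sum is
    maximal, since a strictly larger root has a strictly larger sum. *)
Lemma maxr_ex P x b : pos b -> outside P b -> eff P (x - coroot b) ->
  exists a, maxr P x a.
Proof.
move=> pb ob eb; pose h a : R := \sum_(c in Delta) cf c (val a).
pose D a := [&& pos a, outside P a & `[< eff P (x - coroot a) >]].
have Db : D b by rewrite /D pb ob; apply/asboolP.
have [a /and3P[pa oa /asboolP ea] amax] := arg_maxP h Db.
exists a; split=> // c pc ec ac.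
have oc : outside P c.
  have [d /andP[dP d0]] := existsP oa; apply/existsP; exists d.
  by rewrite dP (lt_le_trans d0).
have Dc : D c by rewrite /D pc oc; apply/asboolP.
have := amax _ Dc; apply: contraPP => ca.
have [d dD cad] : exists2 d, d \in Delta & cf d (val a) != cf d (val c).
  case: (pselect (exists2 d, d \in Delta & cf d (val a) != cf d (val c))) => // hn.
  case: ca; apply/root_inj/cf_inj => d dD.
  by apply/eqP; apply: contra_notT hn => hd; exists d; rewrite 1?eq_sym.
apply/negP; rewrite -ltNge /h (bigD1 d) //= [ltRHS](bigD1 d) //=.
by rewrite ltr_leD ?ler_sum // lt_neqAle cad ac.
Qed.

Lemma vgreedy_ex P x : P \subset Delta -> eff P x -> exists s, vgreedy P x s.
Proof.
move=> PD; move: x; apply: eff_ind => x ex IH.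
case: (pselect (exists2 b, b \notin P & ccf b x != 0)) => [[b bP b0]|h]; last first.
  by exists [::] => b bP; apply/eqP; apply: contra_notT h => ?; exists b.
have bD : b \in Delta by apply: contraNT b0 => bD; rewrite ccf_out.
have cb0 : 0 < cf b x by rewrite lt0r -ccf_eq0 b0 (eff_cf_ge0 ex).
have ob : outside P b by apply/existsP; exists b; rewrite bP cf_simple // eqxx ltr01.
have [a [pa oa ea am]] := maxr_ex (pos_simple bD) ob (eff_sub_simple ex bD cb0).
have [|s sP] := IH _ ea; last by exists (a :: s).
by rewrite heightB; have := height_coroot_ge1 pa oa; lra.
Qed.

End Degrees.

(** * Maximal roots *)

Section MaximalRoots.
Variables (R : realType) (V : vectType R) (Phi : basedRootSystem V).

Local Notation root := (rootset Phi).
Local Notation Delta := (simples Phi).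
Local Notation "''[' u , v ]" := (rform Phi u v) : ring_scope.
Local Notation val a := (fsval a).

Implicit Types (a b c d i : root) (x y : V) (P : {set root}).

Lemma coroot_neq0 a : coroot a != 0.
Proof. by rewrite corootE scaler_eq0 (gt_eqF (coroot_scale_gt0 a)) (negbTE (root_neq0 a)). Qed.

(** If (a, i) < 0, the root d with d^vee = a^vee + i^vee dominates a and still fits into x, against
    maximality. This sign condition is what makes the letters of a greedy list commute. *)
Lemma maxr_dot_ge0 x a i : maxr set0 x a -> i \in Delta ->
  0 < cf i (x - coroot a) -> 0 <= '[val a, val i].
Proof.
move=> [pa _ ea am] iD ci; rewrite leNgt; apply/negP => ai.
have aNi : a != opp_root i by apply: contraTneq pa => ->; rewrite pos_oppE pos_simple.
have [d [Ed [k k1 vd]]] := coroot_addition ai aNi.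
have m0 : '[val a, coroot i] < 0 by rewrite dot_coroot_lt0.
have ad c : cf c (val a) <= cf c (val d).
  rewrite vd cfB !cfZ.
  have := pos_cf c pa; have := pos_cf c (pos_simple iD); nra.
have pd : pos d by apply/posP => c _; apply: le_trans (ad c); exact: pos_cf.
have dE : d = a.
  apply: am => //; rewrite Ed opprD addrA; exact: eff_sub_simple.
move/eqP: Ed; rewrite dE -subr_eq0 opprD addrA subrr sub0r oppr_eq0.
by rewrite (negbTE (coroot_neq0 i)).
Qed.

(* An irreducible root system has at most two root lengths; here a and b lie in
   the same component because a <= b. *)
Lemma two_lengths a b c : pos a -> (forall i, cf i (val a) <= cf i (val b)) ->
  '[val a, val a] < '[val b, val b] -> '[val a, val c] != 0 ->
  2 * '[val c, val c] <= '[val a, val a] -> False.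
Proof.
move=> pa ab lab ac lca.
(* Non-orthogonal roots of different lengths have squared lengths in ratio 2 or 3: the product of
   their Cartan integers is below 4 and the smaller one is 1. *)
have ratio (d e : root) : '[val d, val e] != 0 -> '[val e, val e] < '[val d, val d] ->
    '[val d, val d] = 2 * '[val e, val e] \/ '[val d, val d] = 3 * '[val e, val e].
  move=> de led.
  have dne : d != e by apply: contraTneq led => ->; rewrite ltxx.
  have dNe : d != opp_root e.
    by apply: contraTneq led => ->; rewrite opp_rootE dotNl dotNr opprK ltxx.
  wlog: d led dne dNe de / 0 < '[val d, val e] => [IH|].
    move: de; rewrite neq_lt => /orP[] de; last by apply: IH => //; rewrite gt_eqF.
    have := IH (opp_root d); rewrite opp_rootE !dotNl !dotNr opprK; apply => //.
    - by rewrite (inv_eq (@opp_rootK _ _ Phi)).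
    - by rewrite (inj_eq (inv_inj (@opp_rootK _ _ Phi))).
    - by rewrite oppr_eq0 lt_eqF.
    - by rewrite oppr_gt0.
  move=> {}de; have h4 := cartan_lt4 dne dNe.
  have p0 : 0 < '[val d, coroot e] by rewrite dot_coroot_gt0.
  have q0 : 0 < '[val e, coroot d] by rewrite dot_coroot_gt0 dotC.
  have Ep := dot_coroot_sqn e (val d); have Eq := dot_coroot_sqn d (val e).
  rewrite (dotC (val e) (val d)) in Eq.
  have e0 := sqn_gt0 e; have d0 := sqn_gt0 d.
  have pZ := dot_coroot_int e d; have qZ := dot_coroot_int d e.
  have pq : '[val e, coroot d] < '[val d, coroot e].
    rewrite -(ltr_pM2r d0) Eq -Ep ltr_pM2l //.
  have q1 : '[val e, coroot d] = 1.
    case: (int_eq1_or_ge2 qZ q0) => // q2; nra.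
  rewrite q1 mul1r -Ep in Eq; rewrite q1 mulr1 in h4.
  have := int_eq1_or_ge2 pZ p0; case=> [p1|p2]; first by rewrite p1 q1 ltxx in pq.
  have := int_eq1_or_ge2 (rpredB pZ (rpred1 _)); case; first lra.
    by move=> p1; left; rewrite Eq; congr (_ * _); lra.
  move=> p3; right; rewrite Eq; congr (_ * _).
  have := int_eq1_or_ge2 (rpredB pZ (rpredD (rpred1 _) (rpred1 _))); case; lra.
(* [C e] says that some root as long as b is not orthogonal to e; it serves as a substitute for
   membership in the component of b. *)
pose C (e : root) := exists2 d : root,
  '[val d, val d] = '[val b, val b] & '[val d, val e] != 0.
(* A root d as long as b and not orthogonal to a may be taken non-orthogonal to c as well, after
   reflecting it in a. Then (d, d) is at most 3 (c, c) but at least 2 (a, a), hence at least 4 (c,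
   c). *)
have noC : ~ C a.
  move=> [d Ed da]; have dc : '[val d, val c] = 0.
    apply/eqP; apply: contraT => dc; have c0 := sqn_gt0 c.
    by have := ratio _ _ dc; rewrite Ed; have := ratio _ _ da; rewrite Ed => /(_ lab); lra.
  have dc' : '[val (reflection_root a d), val c] != 0.
    rewrite reflection_rootE dotBl dotZl dc sub0r oppr_eq0 mulf_eq0.
    by rewrite dot_coroot_eq0 (negbTE da) (negbTE ac).
  have c0 := sqn_gt0 c; have := ratio _ _ dc'; rewrite sqn_reflection Ed.
  have := ratio _ _ da; rewrite Ed => /(_ lab); lra.
have CP (e : root) : C e \/
    forall d : root, '[val d, val d] = '[val b, val b] -> '[val d, val e] = 0.
  case: (pselect (C e)) => h; [by left|right=> d Ed].
  by apply/eqP; apply: contra_notT h => ?; exists d.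
have a0 (d : root) : '[val d, val d] = '[val b, val b] -> '[val d, val a] = 0.
  by case: (CP a) => [/noC|/(_ d)].
(* Reflecting in e a root d as long as b that is not orthogonal to e gives another root of that
   length; f is orthogonal to both, hence to e. *)
have CC (e f : root) : C e -> ~ C f -> '[val e, val f] = 0.
  move=> [d Ed de] nf; case: (CP f) => // f0.
  have := f0 (reflection_root e d); rewrite sqn_reflection => /(_ Ed).
  rewrite reflection_rootE dotBl dotZl (f0 d Ed) sub0r => /eqP.
  by rewrite oppr_eq0 mulf_eq0 dot_coroot_eq0 (negbTE de) => /eqP.
have [i iD /andP[ci ai]] := pos_ex_dot_gt0 pa.
have nCi : ~ C i.
  by move=> Ci; move: ai; rewrite dotC (CC _ _ Ci noC) ltxx.
(* The part of b on simple roots outside C. It is orthogonal to b and to the rest of b, so it is 0;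
   but its i-coordinate is that of b, at least the positive one of a. *)
pose y := \sum_(j in Delta | ~~ `[< C j >]) cf j (val b) *: val j.
have y0 : y = 0.
  apply: (@dot_eq0 _ _ Phi); transitivity '[y, val b].
    rewrite [in RHS](cf_sum Phi (val b)) (bigID (fun j => `[< C j >])) /=.
    rewrite -/y dotDr -[LHS]add0r; congr (_ + _); apply/esym.
    rewrite dotC dot_suml big1 // => j /andP[_ /asboolP Cj].
    rewrite dotZl dotC dot_suml big1 ?mulr0 // => l /andP[_ /asboolP nCl].
    by rewrite dotZl dotC CC ?mulr0.
  rewrite dot_suml big1 // => j /andP[_ /asboolP nCj].
  by rewrite dotZl dotC; case: (CP j) => // ->; rewrite ?mulr0.
have : cf i y = cf i (val b).
  rewrite /y raddf_sum /= (bigD1 i) /=; last by rewrite iD; apply/asboolP.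
  rewrite cfZ (cf_simple iD iD) eqxx mulr1 big1 ?addr0 // => j /andP[/andP[jD _] ji].
  by rewrite cfZ (cf_simple iD jD) eq_sym (negbTE ji) mulr0.
by rewrite y0 raddf0 => E; have := ab i; rewrite -E; lra.
Qed.

Lemma simple_dot_le0 i j : i \in Delta -> j \in Delta -> j != i -> '[val j, val i] <= 0.
Proof.
move=> iD jD ji; have := pos_cf i (pos_reflection_simple iD (pos_simple jD) ji).
rewrite reflection_rootE cfB cfZ !cf_simple // eqxx mulr1 eq_sym (negbTE ji).
by rewrite sub0r oppr_ge0 leNgt dot_coroot_gt0 -leNgt.
Qed.

(** This covers the case where a exhausts the i-coordinate of x: replacing a by s_i a lowers the
    degree by exactly i^vee and keeps the first letter maximal. *)
Lemma maxr_reflect x a i : maxr set0 x a -> i \in Delta -> a != i ->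
  0 < '[val a, val i] -> cf i (x - coroot a) = 0 ->
  '[coroot a, val i] = 1 /\ maxr set0 (x - coroot i) (reflection_root i a).
Proof.
move=> [pa _ ea am] iD ai dai cix.
set a' := reflection_root i a.
have pa' : pos a' := pos_reflection_simple iD pa ai.
have m0 : 0 < '[val a, coroot i] by rewrite dot_coroot_gt0.
have i0 := sqn_gt0 i.
have da'i : '[val a', coroot i] = - '[val a, coroot i].
  by rewrite reflection_rootE dotBl dotZl dot_rootK; ring.
have va : val a = val a' + '[val a, coroot i] *: val i.
  by rewrite reflection_rootE subrK.
have a'i : '[val a', val i] < 0 by rewrite -dot_coroot_lt0 da'i oppr_lt0.
have notopp (b : root) : pos b -> b != opp_root i.
  by move=> pb; apply: contraTneq pb => ->; rewrite pos_oppE pos_simple.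
have pci c : 0 <= cf c (val i) := pos_cf c (pos_simple iD).
have ca c : cf c (val a) = cf c (val a') + '[val a, coroot i] * cf c (val i).
  by rewrite {1}va cfD cfZ.
have Ecor : coroot a' = coroot a - '[coroot a, val i] *: coroot i.
  exact: coroot_reflection.
have cE c : c != i -> cf c (val a') = cf c (val a).
  by move=> ci; rewrite cf_reflection_simple.
clearbody a'.
(* The root d built from s_i a and i has coroot a^vee - ((a^vee, i) - 1) i^vee and dominates a, so
   maximality gives d = a and the multiple of i^vee vanishes. *)
have c1 : '[coroot a, val i] = 1.
  have [d [Ed [k k1 vd]]] := coroot_addition a'i (notopp _ pa').
  rewrite da'i scaleNr opprK in vd.
  have ad c : cf c (val a) <= cf c (val d).
    rewrite ca vd cfD !cfZ lerD2r; have := pos_cf c pa'; nra.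
  have pd : pos d by apply/posP => c _; apply: le_trans (ad c); exact: pos_cf.
  have Ed' : coroot d = coroot a - ('[coroot a, val i] - 1) *: coroot i.
    by rewrite Ed Ecor scalerBl scale1r opprB addrA addrAC.
  have Z := dot_coroot_intC i a.
  have c0 : 0 < '[coroot a, val i] by rewrite dotC dot_coroot_gt0 dotC.
  have dE : d = a.
    apply: am => //; rewrite Ed' opprD opprK addrA.
    apply: effD; first exact: ea.
    move=> b _; rewrite (ccfZ b (_ - 1)) rpredM ?ccf_coroot_nat ?pos_simple //.
    by rewrite natrEint rpredB ?rpred1 //= subr_ge0 int_gt0_ge1.
  move/eqP: Ed'; rewrite dE -subr_eq0 opprB addrC subrK scaler_eq0.
  by rewrite (negbTE (coroot_neq0 i)) orbF subr_eq0 => /eqP.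
split=> //; have Ea' : coroot a' = coroot a - coroot i.
  by rewrite Ecor c1 scale1r.
split=> //; first exact: outside0.
  by rewrite Ea' opprB addrA subrK.
move=> b pb eb a'b.
have eb1 : @eff _ _ Phi set0 (x - coroot b - coroot i) by rewrite addrAC.
have ebx : @eff _ _ Phi set0 (x - coroot b).
  by apply: eff_subr eb1; exact: pos_simple.
have ciE : cf i (val a) = cf i (val a') + '[val a, coroot i].
  by rewrite {1}va cfD cfZ (cf_simple iD iD) eqxx mulr1.
(* As x - a^vee has no i-coordinate left, a root that fits into x - i^vee has at i at most the
   coroot coordinate of s_i a. *)
have cib : ccf i (coroot b) <= ccf i (coroot a').
  have := eff_cf_ge0 eb1 (b := i); rewrite inE => /(_ isT); rewrite -ccf_ge0.
  rewrite !ccfB; move/eqP: cix; rewrite -ccf_eq0 ccfB Ea' ccfB.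
  by move=> /eqP; lra.
have bNa : b <> a.
  move=> E; move: cib; rewrite E Ea' ccfB (ccf_simple iD iD) eqxx /=; lra.
(* Either b dominates a; or b has the same i-coordinate as s_i a, and then the
   root obtained from b and i dominates a; or the i-coordinate of b lies strictly
   in between, which needs three root lengths. *)
have [cab|cab] := leP (cf i (val a)) (cf i (val b)).
  case: bNa; apply: am => // c; have [->//|ci] := eqVneq c i.
  by rewrite -cE.
have : cf i (val a') <= cf i (val b) by [].
rewrite le_eqVlt => /orP[/eqP ciab|ciab].
  (* Here b - s_i a is a nonnegative combination of simple roots other than i, so it pairs
     nonpositively with i. *)
  have bi : '[val b, coroot i] <= - '[val a, coroot i].
    rewrite -da'i -subr_le0 -dotBl -[_ <= 0](pmulr_lle0 _ i0) dot_coroot_sqn.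
    rewrite pmulr_rle0 ?ltr0n // dot_cf sumr_le0 // => c cD.
    have [->|ci] := eqVneq c i; first by rewrite cfB ciab subrr mul0r.
    by rewrite mulr_ge0_le0 ?simple_dot_le0 // cfB subr_ge0.
  have bi0 : '[val b, val i] < 0 by rewrite -dot_coroot_lt0; lra.
  have [d [Ed [k k1 vd]]] := coroot_addition bi0 (notopp _ pb).
  have cd c : cf c (val d) = k * cf c (val b) - '[val b, coroot i] * cf c (val i).
    by rewrite vd cfB !cfZ.
  have ad c : cf c (val a) <= cf c (val d).
    rewrite cd ca; have := a'b c; have := pos_cf c pa'; have := pci c; nra.
  have pd : pos d by apply/posP => c _; apply: le_trans (ad c); exact: pos_cf.
  have dE : d = a by apply: am => //; rewrite Ed opprD addrA.
  apply: root_inj; apply: (@cf_inj _ _ Phi) => c _; apply/eqP; rewrite eq_le a'b andbT.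
  have h1 : cf c (val b) <= k * cf c (val b) by rewrite ler_peMl // pos_cf.
  have h2 : '[val a, coroot i] * cf c (val i) <= - '[val b, coroot i] * cf c (val i).
    by rewrite ler_wpM2r // lerNr.
  have := cd c; rewrite dE ca; move: h1 h2; clear; lra.
exfalso; have mZ := dot_coroot_int i a.
(* For (a, i^vee) = 1 the i-coordinates of s_i a and a are consecutive integers and leave no room in
   between. *)
have m2 : 2 <= '[val a, coroot i].
  case: (int_eq1_or_ge2 mZ m0) => // m1.
  have [p Ep] := pos_cf_nat i pa'; have [q Eq] := pos_cf_nat i pb.
  move: ciab cab; rewrite ciE m1 Ep Eq natr1 !ltr_nat ltnS => h1 h2.
  by have := leq_ltn_trans h2 h1; rewrite ltnn.
have na' := sqn_gt0 a'; have nb := sqn_gt0 b.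
(* From (a^vee, i) = 1 one gets (a, i^vee) (i, i) = (a, a), so i has at most half the squared length
   of s_i a. *)
have Em : '[val a, coroot i] * '[val i, val i] = '[val a', val a'].
  have := dot_coroot_sqn i (val a'); rewrite da'i.
  have := dot_coroot_sqn a' (val i); rewrite (dotC (val i) (coroot a')).
  rewrite Ea' dotBl c1 dot_rootKC (dotC (val i) (val a')) => <-.
  by rewrite mulNr => h; apply: oppr_inj; rewrite h; ring.
apply: (@two_lengths a' b i) => //; last 2 first.
- by rewrite lt_eqF.
- by rewrite -Em ler_pM2r.
(* The coroot inequality with denominators cleared. Together with the strict opposite inequality
   between root coordinates it makes b longer than s_i a. *)
have {}cib : cf i (val b) * '[val a', val a'] <= cf i (val a') * '[val b, val b].
  rewrite -(ler_pM2r (divr_gt0 i0 (mulr_gt0 na' nb))).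
  move: cib; rewrite /ccf !corootE !cfZ; congr (_ <= _).
    by field; rewrite !gt_eqF.
  by field; rewrite !gt_eqF.
rewrite ltNge; apply/negP => lba.
have c0 := pos_cf i pa'.
have : cf i (val b) * '[val b, val b] <= cf i (val a') * '[val b, val b].
  by apply: le_trans cib; rewrite ler_wpM2l // (le_trans c0) // ltW.
by rewrite ler_pM2r // leNgt ciab.
Qed.

End MaximalRoots.

(** * The Weyl group and the Hecke product *)

Section Weyl.
Variables (R : realType) (V : vectType R) (Phi : basedRootSystem V).

Local Notation root := (rootset Phi).
Local Notation Delta := (simples Phi).
Local Notation "''[' u , v ]" := (rform Phi u v) : ring_scope.
Local Notation val a := (fsval a).
Local Notation W := (weyl Phi).
Local Notation word := (all (fun b : root => b \in Delta)).

Implicit Types (a b c d i : root) (x y : V) (P : {set root}).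
Implicit Types (u v w : {perm root}) (s t : seq root).
Local Open Scope group_scope.

Lemma gen_ind (gT : finGroupType) (A : {set gT}) (Q : gT -> Prop) :
  Q 1 -> (forall x y : gT, x \in A -> y \in <<A>> -> Q y -> Q (x * y)) ->
  forall x : gT, x \in <<A>> -> Q x.
Proof.
move=> Q1 QM x /gen_prodgP[n [c cA ->]].
elim: n c cA => [|n IH] c cA; first by rewrite big_ord0.
rewrite big_ord_recl; apply: QM => //; last by apply: IH => i; exact: cA.
by apply: group_prod => i _; rewrite mem_gen.
Qed.

Lemma reflE a b : refl a b = reflection_root a b.
Proof. by rewrite permE. Qed.

Lemma reflK a : refl a * refl a = 1.
Proof. by apply/permP => b; rewrite permM perm1 !reflE reflection_rootK. Qed.

Lemma reflV a : (refl a)^-1 = refl a.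
Proof. by apply/eqP; rewrite eq_invg_mul reflK. Qed.

Lemma reflKl a w : refl a * (refl a * w) = w.
Proof. by rewrite mulgA reflK mul1g. Qed.

Lemma reflKr a w : w * refl a * refl a = w.
Proof. by rewrite -mulgA reflK mulg1. Qed.

Lemma refl_opp a : refl (opp_root a) = refl a.
Proof. by apply/permP => b; rewrite !reflE reflection_oppl. Qed.

Lemma refl_weyl a : refl a \in W.
Proof. by rewrite mem_gen // imset_f. Qed.

(** Weyl elements are stored as permutations of roots; this recovers the linear isometry behind
    them, from which conjugation of reflections and linearity on spans follow. *)
Definition isometric w := exists f : V -> V,
  [/\ linear f, forall x y, '[f x, f y] = '[x, y]%R & forall a, val (w a) = f (val a)].

Lemma weyl_isometric w : w \in W -> isometric w.
Proof.
move: w; apply: gen_ind => [|_ v /imsetP[a _ ->] _ [f [lf df wf]]].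
  by exists id; split=> // a; rewrite perm1.
exists (fun x => f (x - '[x, coroot a] *: val a)%R); split=> [k x y|x y|b].
- rewrite -lf; congr f; rewrite dotDl dotZl scalerDl opprD scalerBr scalerA.
  by rewrite addrACA.
- by rewrite df reflection_dot.
- by rewrite permM wf reflE reflection_rootE.
Qed.

Lemma weyl_opp w a : w \in W -> w (opp_root a) = opp_root (w a).
Proof.
move=> /weyl_isometric[f [lf _ wf]]; apply: root_inj.
rewrite opp_rootE !wf opp_rootE -[(- _)%R]scaleN1r.
have f0 : f 0%R = 0%R by have := lf (-1)%R 0%R 0%R; rewrite scaler0 addr0 scaleN1r addNr.
by have := lf (-1)%R (val a) 0%R; rewrite !addr0 f0 addr0 => ->; rewrite scaleN1r.
Qed.

Lemma weyl_conj w a : w \in W -> refl a * w = w * refl (w a).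
Proof.
move=> /weyl_isometric[f [lf df wf]]; apply/permP => b; apply: root_inj.
rewrite !permM !reflE reflection_rootE !wf reflection_rootE.
have fB x y k : f (x - k *: y)%R = (f x - k *: f y)%R.
  by have /= := lf (- k)%R y x; rewrite !scaleNr ![(- _ + _)%R]addrC.
rewrite fB; congr (_ - _ *: _)%R.
by rewrite !corootE !dotZr !wf !df.
Qed.

Lemma refl_reflection a b :
  refl (reflection_root a b) = refl a * refl b * refl a.
Proof.
by rewrite -mulgA (weyl_conj b (refl_weyl a)) reflE reflKl.
Qed.

Lemma refl_ind (G : {group {perm root}}) :
  {in Delta, forall b, refl b \in G} -> forall a, refl a \in G.
Proof.
move=> GD; have Gp : forall a, pos a -> refl a \in G.
  apply: (@pos_ind _ _ _ (fun a => refl a \in G)) => [i /GD//|i a iD _ _ _ Ga _].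
  by have Gi := GD i iD; rewrite refl_reflection !groupM.
move=> a; case: (boolP (pos a)) => [/Gp//|]; rewrite -pos_oppE => /Gp.
by rewrite refl_opp.
Qed.

Lemma weyl_simple : W :=: <<simple_refls Phi>>.
Proof.
apply/eqP; rewrite eqEsubset; apply/andP; split; last first.
  by apply: genS; apply/subsetP => _ /imsetP[b _ ->]; rewrite imset_f.
rewrite gen_subG; apply/subsetP => _ /imsetP[a _ ->].
apply: (@refl_ind [group of <<simple_refls Phi>>]) => b bD /=.
by rewrite mem_gen // imset_f.
Qed.

(** * Words and length *)

Definition prodw t : {perm root} := \prod_(b <- t) refl b.

Lemma prodw_cons b t : prodw (b :: t) = refl b * prodw t.
Proof. by rewrite /prodw big_cons. Qed.

Lemma prodw_rcons b t : prodw (rcons t b) = prodw t * refl b.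
Proof. by rewrite /prodw -cats1 big_cat big_seq1. Qed.

Lemma prodw_weyl t : prodw t \in W.
Proof. by apply: group_prod => b _; exact: refl_weyl. Qed.

Lemma prodwV t : (prodw t)^-1 = prodw (rev t).
Proof.
elim: t => [|b t IH]; first by rewrite /prodw !big_nil invg1.
by rewrite prodw_cons invMg IH reflV rev_cons prodw_rcons.
Qed.

Lemma expgs_wordP n w :
  reflect (exists t, [/\ word t, size t = n & prodw t = w]) (w \in simple_refls Phi ^+ n).
Proof.
elim: n w => [|n IH] w.
  rewrite expg0 inE; apply: (iffP eqP) => [->|[t [_ /size0nil -> <-]]].
    by exists [::]; rewrite /prodw big_nil.
  by rewrite /prodw big_nil.
rewrite expgS; apply: (iffP idP) => [/mulsgP[_ v /imsetP[b bD ->] /IH[t [tD <- <-]] ->]|].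
  by exists (b :: t); rewrite /= bD prodw_cons.
case=> -[|b t] [] // /andP[bD tD] [sn] <-; rewrite prodw_cons mem_mulg ?imset_f //.
by apply/IH; exists t.
Qed.

Lemma wlength_word w : w \in W ->
  exists t, [/\ word t, size t = wlength w & prodw t = w].
Proof.
rewrite weyl_simple => wS; rewrite /wlength; case: ex_minnP => n.
by rewrite wS => /expgs_wordP.
Qed.

Lemma wlength_le t : word t -> (wlength (prodw t) <= size t)%N.
Proof.
move=> tD; rewrite /wlength; case: ex_minnP => n _; apply.
by apply/implyP => _; apply/expgs_wordP; exists t.
Qed.

Lemma wlengthV w : w \in W -> wlength w^-1 = wlength w.
Proof.
have H v : v \in W -> (wlength v^-1 <= wlength v)%N.
  move=> /wlength_word[t [tD <- {1}<-]]; rewrite prodwV -size_rev wlength_le //.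
  by rewrite all_rev.
by move=> wW; apply/eqP; rewrite eqn_leq H //= -{1}[w]invgK H ?groupV.
Qed.

(* Following a along the word, its image turns negative exactly at a letter
   equal to the current image; that letter can be deleted. *)
Lemma exchange P t a : P \subset Delta -> all (fun b => b \in P) t ->
  pos a -> ~~ pos (prodw t a) ->
  exists s, [/\ all (fun b => b \in P) s, (size s < size t)%N & refl a * prodw t = prodw s].
Proof.
move=> /subsetP PD; elim: t a => [|b t IH] a /=; first by rewrite /prodw big_nil perm1 => _ ->.
move=> /andP[bP tP] pa; rewrite prodw_cons permM reflE.
have [->|ab] := eqVneq a b; first by move=> _; exists t; rewrite reflKl.
move=> /(IH _ tP (pos_reflection_simple (PD _ bP) pa ab))[s [sP ss E]].
exists (b :: s); rewrite /= bP; split=> //.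
by rewrite mulgA (weyl_conj a (refl_weyl b)) reflE -mulgA E prodw_cons.
Qed.

(** Since permutations compose from left to right, w acts on roots as the inverse of the usual
    linear map; this is the classical criterion w^-1 a > 0. If [w a] is negative, [exchange]
    shortens a reduced word; the other direction applies this to [refl a * w]. *)
Lemma wlength_refl_gt w a : w \in W -> pos a ->
  (wlength w < wlength (refl a * w))%N = pos (w a).
Proof.
have H v : v \in W -> pos a -> ~~ pos (v a) -> (wlength (refl a * v) < wlength v)%N.
  move=> /wlength_word[t [tD <- {1 2}<-]] pa /(exchange (subxx _) tD pa)[s [sD ss ->]].
  exact: leq_ltn_trans (wlength_le sD) ss.
move=> wW pa; apply/idP/idP => [lw|pw].
  by apply: contraTT lw => /(H _ wW pa) lw; rewrite -leqNgt ltnW.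
rewrite -{1}(reflKl a w) H ?groupM ?refl_weyl // permM reflE.
by rewrite -/(opp_root a) weyl_opp // pos_oppE negbK.
Qed.

Lemma wlength_mulr_gt w a : w \in W -> pos a ->
  (wlength w < wlength (w * refl a))%N = pos (w^-1 a).
Proof.
move=> wW pa; rewrite -wlengthV // -[wlength (w * _)]wlengthV ?groupM ?refl_weyl //.
by rewrite invMg reflV wlength_refl_gt ?groupV.
Qed.

(** * The Hecke product from the left and from the right *)

Definition lhecke_simple i w : {perm root} := if pos (w i) then refl i * w else w.

Lemma hecke_simpleE w i : w \in W -> i \in Delta ->
  hecke_simple w i = if pos (w^-1 i) then w * refl i else w.
Proof. by move=> wW iD; rewrite /hecke_simple wlength_mulr_gt // pos_simple. Qed.

Lemma lhecke_simpleV i w : w \in W -> i \in Delta ->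
  lhecke_simple i w^-1 = (hecke_simple w i)^-1.
Proof.
move=> wW iD; rewrite hecke_simpleE // /lhecke_simple.
by case: ifP => // _; rewrite invMg reflV.
Qed.

Lemma hecke_simple_weyl w i : w \in W -> hecke_simple w i \in W.
Proof. by move=> wW; rewrite /hecke_simple; case: ifP; rewrite ?groupM ?refl_weyl. Qed.

Lemma lhecke_simple_weyl w i : w \in W -> lhecke_simple i w \in W.
Proof. by move=> wW; rewrite /lhecke_simple; case: ifP; rewrite ?groupM ?refl_weyl. Qed.

Lemma pos_refl_simple i a : i \in Delta -> pos a -> a != i -> pos (refl i a).
Proof. by rewrite reflE; exact: pos_reflection_simple. Qed.

Lemma refl_simple i : refl i i = opp_root i.
Proof. by rewrite reflE. Qed.

Lemma neg_refl_simple i a : i \in Delta -> ~~ pos a -> a != opp_root i -> ~~ pos (refl i a).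
Proof.
move=> iD; rewrite -pos_oppE => pa ai.
have : pos (refl i (opp_root a)).
  by apply: pos_refl_simple; rewrite // (inv_eq (@opp_rootK _ _ Phi)).
by rewrite weyl_opp ?refl_weyl // pos_oppE.
Qed.

(** This commutation is the source of associativity. The two operators interact only if w carries i
    to j or to -j; when [w i = j], both sides equal s_i w = w s_j. *)
Lemma lrhecke_simple i j w : w \in W -> i \in Delta -> j \in Delta ->
  lhecke_simple i (hecke_simple w j) = hecke_simple (lhecke_simple i w) j.
Proof.
move=> wW iD jD; rewrite !hecke_simpleE ?lhecke_simple_weyl //.
have wVW : w^-1 \in W by rewrite groupV.
have [pwi|nwi] := boolP (pos (w i)); have [pwj|nwj] := boolP (pos (w^-1 j));
  rewrite /lhecke_simple ?permM ?(negbTE nwi) ?(negbTE nwj) ?pwi ?pwj //.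
- rewrite invMg reflV permM; have [E|wij] := eqVneq (w i) j.
    have -> : w^-1 j = i by rewrite -E permK.
    rewrite E !refl_simple !pos_oppE !pos_simple //=.
    by rewrite weyl_conj // E.
  rewrite !pos_refl_simple ?mulgA //.
  by apply: contraNneq wij => <-; rewrite permKV.
- rewrite invMg reflV permM (negbTE (neg_refl_simple _ _ _)) //.
  apply: contraTneq pwi => /(congr1 w); rewrite permKV weyl_opp // => E.
  by rewrite -pos_oppE -E pos_simple.
- rewrite (negbTE (neg_refl_simple _ _ _)) //.
  apply: contraTneq pwj => /(congr1 w^-1); rewrite permK weyl_opp // => E.
  by rewrite -pos_oppE -E pos_simple.
Qed.

Definition demazure t : {perm root} := foldl (@hecke_simple R V Phi) 1 t.
Definition ldemazure t w : {perm root} := foldr lhecke_simple w t.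

Lemma foldl_hecke_weyl u t : u \in W -> foldl (@hecke_simple R V Phi) u t \in W.
Proof. by elim: t u => //= b t IH u uW; rewrite IH ?hecke_simple_weyl. Qed.

Lemma ldemazure_weyl t u : u \in W -> ldemazure t u \in W.
Proof. by move=> uW; elim: t => //= b t; exact: lhecke_simple_weyl. Qed.

Lemma ldemazure_foldl s t u : word s -> word t -> u \in W ->
  foldl (@hecke_simple R V Phi) (ldemazure s u) t =
  ldemazure s (foldl (@hecke_simple R V Phi) u t).
Proof.
move=> sD; elim: t u => //= b t IH u /andP[bD tD] uW.
rewrite -IH ?hecke_simple_weyl //; congr foldl.
elim: s sD {IH} => //= i s IHs /andP[iD sD]; rewrite -IHs // lrhecke_simple //.
exact: ldemazure_weyl.
Qed.

Lemma reduced_wordP w : w \in W ->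
  [/\ word (reduced_word w), size (reduced_word w) = wlength w & prodw (reduced_word w) = w].
Proof.
move=> /wlength_word[t [tD ts tw]]; rewrite /reduced_word; case: pickP => [s|].
  by move=> /= /andP[sD /eqP ws]; rewrite size_tuple; split.
have ts' : size t == wlength w by apply/eqP.
by move=> /(_ (Tuple ts')); rewrite /= tD -/(prodw t) tw eqxx.
Qed.

Lemma demazure_reduced t : word t -> (size t <= wlength (prodw t))%N ->
  demazure t = prodw t.
Proof.
rewrite /demazure; elim/last_ind: t => [|t b IH]; first by rewrite /prodw big_nil.
rewrite all_rcons size_rcons prodw_rcons foldl_rcons => /andP[bD tD] lt.
have lt1 : (wlength (prodw t * refl b) <= (wlength (prodw t)).+1)%N.
  have [s [sD <- <-]] := wlength_word (prodw_weyl t).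
  by rewrite -prodw_rcons (leq_trans (wlength_le _)) ?size_rcons // all_rcons bD.
rewrite IH //; first last.
  by rewrite -ltnS (leq_trans lt).
by rewrite /hecke_simple (leq_trans _ lt) // ltnS wlength_le.
Qed.

Lemma demazure_reduced_word w : w \in W -> demazure (reduced_word w) = w.
Proof.
move=> wW; have [rD rs rw] := reduced_wordP wW.
by rewrite demazure_reduced // rw ?rs.
Qed.

Lemma ldemazure_ex w : w \in W -> exists2 t, word t & ldemazure t 1 = w.
Proof.
move=> wW; have wVW : w^-1 \in W by rewrite groupV.
have [rD _ _] := reduced_wordP wVW; exists (rev (reduced_word w^-1)).
  by rewrite all_rev.
rewrite -[RHS]invgK -[in RHS](demazure_reduced_word wVW) /demazure.
rewrite /ldemazure -(foldl_rev (fun v b => lhecke_simple b v)) revK -[X in foldl _ X]invg1.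
have : (1 : {perm root}) \in W by rewrite group1.
elim: (reduced_word _) 1 rD => //= b t IH u /andP[bD tD] uW.
by rewrite lhecke_simpleV // IH // hecke_simple_weyl.
Qed.

(** The word t need only consist of simple roots, reduced or otherwise. Writing u as left operators
    applied to 1 and moving them outside, both sides become these operators applied to
    [demazure t]. *)
Lemma hecke_demazure u t : u \in W -> word t ->
  hecke u (demazure t) = foldl (@hecke_simple R V Phi) u t.
Proof.
move=> /ldemazure_ex[s sD <-] tD.
have dW : demazure t \in W by rewrite foldl_hecke_weyl ?group1.
have [rD _ _] := reduced_wordP dW.
rewrite /hecke !ldemazure_foldl ?group1 // -/(demazure _) demazure_reduced_word //.
Qed.

Lemma hecke_ldemazure s v : word s -> v \in W -> hecke (ldemazure s 1) v = ldemazure s v.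
Proof.
move=> sD vW; have [rD _ _] := reduced_wordP vW.
by rewrite /hecke ldemazure_foldl ?group1 // -/(demazure _) demazure_reduced_word.
Qed.

Lemma demazure_ex w : w \in W -> exists2 t, word t & demazure t = w.
Proof.
move=> wW; have [rD _ _] := reduced_wordP wW.
by exists (reduced_word w) => //; exact: demazure_reduced_word.
Qed.

Lemma hecke_weyl u v : u \in W -> v \in W -> hecke u v \in W.
Proof. by move=> uW vW; rewrite /hecke foldl_hecke_weyl. Qed.

Lemma demazure_cat s t :
  demazure (s ++ t) = foldl (@hecke_simple R V Phi) (demazure s) t.
Proof. by rewrite /demazure foldl_cat. Qed.

Lemma heckeA u v w : u \in W -> v \in W -> w \in W ->
  hecke u (hecke v w) = hecke (hecke u v) w.
Proof.
move=> uW /demazure_ex[s sD <-] /demazure_ex[t tD <-].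
have sW : demazure s \in W by rewrite foldl_hecke_weyl ?group1.
rewrite [hecke (demazure s) _]hecke_demazure // -demazure_cat.
by rewrite !hecke_demazure ?hecke_weyl ?all_cat ?sD ?foldl_hecke_weyl // foldl_cat.
Qed.

Lemma demazure0 : demazure [::] = 1. Proof. by []. Qed.

Lemma hecke1r u : u \in W -> hecke u 1 = u.
Proof. by move=> uW; rewrite -demazure0 hecke_demazure. Qed.

Lemma hecke1l u : u \in W -> hecke 1 u = u.
Proof. by move=> uW; rewrite -[X in hecke X]/(ldemazure [::] 1) hecke_ldemazure. Qed.

Lemma hecke_refl_simple u i : u \in W -> i \in Delta ->
  hecke u (refl i) = if pos (u^-1 i) then u * refl i else u.
Proof.
move=> uW iD; have E : demazure [:: i] = refl i.
  by rewrite /demazure /= hecke_simpleE ?group1 // invg1 perm1 pos_simple // mul1g.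
by rewrite -{1}E hecke_demazure /= ?iD // hecke_simpleE.
Qed.

Lemma hecke_simple_refl u i : u \in W -> i \in Delta ->
  hecke (refl i) u = if pos (u i) then refl i * u else u.
Proof.
move=> uW iD; have E : ldemazure [:: i] 1 = refl i.
  by rewrite /= /lhecke_simple perm1 pos_simple // mulg1.
by rewrite -{1}E hecke_ldemazure /= ?iD.
Qed.

Lemma hecke_simpleK i : i \in Delta -> hecke (refl i) (refl i) = refl i :> {perm root}.
Proof.
move=> iD; rewrite hecke_refl_simple ?refl_weyl // reflV refl_simple.
by rewrite pos_oppE pos_simple.
Qed.

End Weyl.

(** * The Bruhat order *)

Section Bruhat.
Variables (R : realType) (V : vectType R) (Phi : basedRootSystem V).

Local Notation root := (rootset Phi).
Local Notation Delta := (simples Phi).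
Local Notation "''[' u , v ]" := (rform Phi u v) : ring_scope.
Local Notation val a := (fsval a).
Local Notation cf := (@cf R V Phi).
Local Notation W := (weyl Phi).
Local Notation "u ** v" := (hecke u v) (at level 40, left associativity).

Implicit Types (a b c d i : root) (P : {set root}).
Implicit Types (u v w y z : {perm root}) (s t : seq root).
Local Open Scope group_scope.

Lemma bruhat_refl u : bruhat u u. Proof. exact: connect0. Qed.

Lemma bruhat_trans v u w : bruhat u v -> bruhat v w -> bruhat u w.
Proof. exact: connect_trans. Qed.

Lemma bruhat_ind (Q : {perm root} -> {perm root} -> Prop) :
  (forall u, u \in W -> Q u u) ->
  (forall u v w, u \in W -> bruhat_step u v -> Q v w -> Q u w) ->
  forall u v, u \in W -> bruhat u v -> Q u v.
Proof.
move=> Q0 Q1 u v uW /connectP[p]; elim: p u uW => /= [u uW _ ->|w p IH u uW]; first exact: Q0.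
move=> /andP[uw wp] E; apply: (Q1 _ w) => //; apply: IH => //.
by case/existsP: uw => a /andP[/eqP -> _]; rewrite groupM ?refl_weyl.
Qed.

Lemma bruhat_weyl u v : u \in W -> bruhat u v -> v \in W.
Proof.
move=> uW uv; move: (uW); move: u v uW uv; apply: bruhat_ind => // u v w uW.
by case/existsP=> a /andP[/eqP -> _] IH _; rewrite IH // groupM ?refl_weyl.
Qed.

Lemma bruhat_length u v : u \in W -> bruhat u v -> u = v \/ (wlength u < wlength v)%N.
Proof.
move: u v; apply: bruhat_ind => [u _|u v w _]; first by left.
case/existsP=> a /andP[_ lt] [<-|lt']; right => //; exact: ltn_trans lt'.
Qed.

Lemma bruhat_anti u v : u \in W -> bruhat u v -> bruhat v u -> u = v.
Proof.
move=> uW uv vu; have vW := bruhat_weyl uW uv.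
have [//|lt] := bruhat_length uW uv; have [//|lt'] := bruhat_length vW vu.
by have := ltn_trans lt lt'; rewrite ltnn.
Qed.

Lemma bruhat_stepP u v : u \in W -> bruhat_step u v ->
  exists a, [/\ pos a, v = u * refl a & pos (u^-1 a)].
Proof.
move=> uW /existsP[a /andP[/eqP -> lt]]; case: (boolP (pos a)) => pa.
  by exists a; rewrite -wlength_mulr_gt.
move: pa lt; rewrite -pos_oppE -refl_opp => pa lt.
by exists (opp_root a); rewrite -wlength_mulr_gt.
Qed.

Lemma bruhat_mulr u a : u \in W -> pos a -> pos (u^-1 a) -> bruhat u (u * refl a).
Proof.
move=> uW pa pua; apply/connect1/existsP; exists a; rewrite eqxx /=.
by rewrite wlength_mulr_gt.
Qed.

Lemma bruhatV u v : u \in W -> bruhat u v -> bruhat u^-1 v^-1.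
Proof.
move: u v; apply: bruhat_ind => [u _|u v w uW]; first exact: bruhat_refl.
move=> uv; apply: bruhat_trans; apply: connect1; case/existsP: uv => a /andP[/eqP -> lt].
apply/existsP; exists (u^-1 a); rewrite !wlengthV ?groupM ?refl_weyl // lt andbT.
by rewrite invMg reflV weyl_conj ?groupV.
Qed.

Lemma hecke_simple_ge u i : bruhat u (hecke_simple u i).
Proof.
rewrite /hecke_simple; case: ifP => lt; last exact: bruhat_refl.
by apply/connect1/existsP; exists i; rewrite eqxx.
Qed.

Lemma mulr_le_hecke_simple u i : u \in W -> i \in Delta ->
  bruhat (u * refl i) (hecke_simple u i).
Proof.
move=> uW iD; rewrite hecke_simpleE //; case: ifP => [_|/negbT np]; first exact: bruhat_refl.
have uiW : u * refl i \in W by rewrite groupM ?refl_weyl.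
rewrite -[X in bruhat _ X](reflKr i); apply: bruhat_mulr => //; first exact: pos_simple.
by rewrite invMg reflV permM refl_simple weyl_opp ?groupV // pos_oppE.
Qed.

(** For a Bruhat step v = u s_a with a different from i, the root s_i a is positive, so u s_i lies
    below u s_i s_(s_i a) = v s_i, and v s_i lies below the Hecke product. If a = i, multiplying u
    by s_i already gives v. *)
Lemma hecke_simple_mono u v i : i \in Delta -> u \in W -> bruhat u v ->
  bruhat (hecke_simple u i) (hecke_simple v i).
Proof.
move=> iD; move: u v; apply: bruhat_ind => [u _|u v w uW]; first exact: bruhat_refl.
move=> uv; apply: bruhat_trans.
have uv' : bruhat u v by apply: connect1.
have vW := bruhat_weyl uW uv'.
have [a [pa Ev pua]] := bruhat_stepP uW uv.
rewrite hecke_simpleE //; case: ifP => pui; last exact: bruhat_trans uv' (hecke_simple_ge _ _).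
have [E|ai] := eqVneq a i.
  by rewrite -E -Ev hecke_simple_ge.
apply: bruhat_trans (mulr_le_hecke_simple vW iD).
have -> : v * refl i = u * refl i * refl (refl i a).
  by rewrite -(mulgA u) -(weyl_conj a (refl_weyl i)) mulgA -Ev.
apply: bruhat_mulr; rewrite ?groupM ?refl_weyl ?pos_refl_simple //.
by rewrite invMg reflV permM -[refl i (refl i a)]permM reflK perm1.
Qed.

Lemma lhecke_simple_mono u v i : i \in Delta -> u \in W -> bruhat u v ->
  bruhat (lhecke_simple i u) (lhecke_simple i v).
Proof.
move=> iD uW uv; have vW := bruhat_weyl uW uv.
have H w : w \in W -> lhecke_simple i w = (hecke_simple w^-1 i)^-1.
  by move=> wW; rewrite -lhecke_simpleV ?groupV // invgK.
rewrite !H //; apply: bruhatV; first by rewrite hecke_simple_weyl ?groupV.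
by apply: hecke_simple_mono; rewrite ?groupV //; exact: bruhatV.
Qed.

(** Monotonicity in v comes from writing u as left simple operators, monotonicity in u from writing
    v' as right ones. *)
Lemma hecke_mono u u' v v' : u \in W -> v \in W -> bruhat u u' -> bruhat v v' ->
  bruhat (u ** v) (u' ** v').
Proof.
move=> uW vW uu' vv'; have u'W := bruhat_weyl uW uu'; have v'W := bruhat_weyl vW vv'.
apply: (@bruhat_trans (u ** v')).
  have [s sD <-] := ldemazure_ex uW; rewrite !hecke_ldemazure //.
  elim: s sD => //= i s IH /andP[iD sD]; apply: lhecke_simple_mono => //.
    exact: ldemazure_weyl.
  exact: IH.
have [t tD <-] := demazure_ex v'W; rewrite !hecke_demazure //.
elim: t u u' tD uW uu' {u'W} => //= i t IH u u' /andP[iD tD] uW uu'.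
by apply: IH => //; [exact: hecke_simple_weyl | exact: hecke_simple_mono].
Qed.

Lemma bruhat1 u : u \in W -> bruhat 1 u.
Proof.
move=> uW; have [t tD <-] := demazure_ex uW.
rewrite /demazure; elim/last_ind: t tD => [_|t i IH]; first exact: bruhat_refl.
rewrite all_rcons foldl_rcons => /andP[_ /IH h].
exact: bruhat_trans h (hecke_simple_ge _ _).
Qed.

Lemma bruhat_heckel u v : u \in W -> v \in W -> bruhat u (u ** v).
Proof.
by move=> uW vW; rewrite -{1}[u]hecke1r //; apply: hecke_mono; rewrite ?bruhat_refl ?bruhat1.
Qed.

Lemma bruhat_hecker u v : u \in W -> v \in W -> bruhat v (u ** v).
Proof.
by move=> uW vW; rewrite -{1}[v]hecke1l //; apply: hecke_mono; rewrite ?bruhat_refl ?bruhat1.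
Qed.

(** * Hecke products of lists of reflections *)

Definition hprod s : {perm root} := foldr (fun a w => refl a ** w) 1 s.

Lemma hprod_weyl s : hprod s \in W.
Proof. by elim: s => //= a s IH; rewrite hecke_weyl ?refl_weyl. Qed.

Lemma foldr_hecke w s : w \in W -> foldr (fun a v => refl a ** v) w s = hprod s ** w.
Proof.
move=> wW; elim: s => /= [|a s ->]; first by rewrite hecke1l.
by rewrite heckeA ?hprod_weyl ?refl_weyl.
Qed.

Lemma hprod_cat s t : hprod (s ++ t) = hprod s ** hprod t.
Proof. by rewrite {1}/hprod foldr_cat foldr_hecke ?hprod_weyl. Qed.

Lemma hprod1 a : hprod [:: a] = refl a.
Proof. by rewrite /= hecke1r ?refl_weyl. Qed.

Section SimpleReflection.
Variables (a i : root).
Hypotheses (pa : pos a) (iD : i \in Delta).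

(** Both multiplications by s_i increase the length: s_a i is positive and differs from i, so s_i
    s_a i is positive too. Hence the ordinary conjugate is also the Hecke conjugate. *)
Lemma hecke_refl_conj : '[val a, val i] < 0 ->
  refl (reflection_root i a) = refl i ** (refl a ** refl i).
Proof.
move=> ai; have ni : a != i.
  by apply: contraTneq ai => ->; rewrite -leNgt ltW ?sqn_gt0.
have pai : pos (refl a i).
  apply/posP => b _; rewrite reflE reflection_rootE cfB cfZ -mulNr.
  apply: addr_ge0; first exact/pos_cf/pos_simple.
  by apply: mulr_ge0 (pos_cf b pa); rewrite oppr_ge0 ltW // dot_coroot_lt0 dotC.
rewrite hecke_refl_simple ?refl_weyl // reflV pai.
rewrite hecke_simple_refl ?groupM ?refl_weyl // permM pos_refl_simple //.
  by rewrite refl_reflection mulgA.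
apply/eqP => /(congr1 (fun b : root => val b)); rewrite reflE reflection_rootE => /eqP.
rewrite -subr_eq0 addrAC subrr sub0r oppr_eq0 scaler_eq0 (negbTE (root_neq0 a)) orbF.
by rewrite dot_coroot_eq0 dotC lt_eqF.
Qed.

(** Here s_a i is negative: for a different from i, subtracting a positive multiple of a makes some
    coordinate other than i negative. *)
Lemma hecke_refl_absorb : 0 < '[val a, val i] ->
  refl a ** refl i = refl a /\ refl i ** refl a = refl a.
Proof.
move=> ai; have npai : pos (refl a i) = false.
  have [->|ni] := eqVneq a i; first by rewrite refl_simple pos_oppE pos_simple.
  have [b bD /andP[bi b0]] := pos_neq_simple iD pa ni.
  apply: (@cf_lt0_neg _ _ _ _ b).
  rewrite reflE reflection_rootE cfB cfZ (cf_simple bD iD) (negbTE bi) sub0r.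
  by rewrite oppr_lt0 mulr_gt0 // dot_coroot_gt0 dotC.
by rewrite hecke_refl_simple ?refl_weyl // hecke_simple_refl ?refl_weyl // reflV npai.
Qed.

Lemma hecke_refl_comm : 0 <= '[val a, val i] ->
  refl a ** refl i = refl i ** refl a.
Proof.
rewrite le0r => /orP[/eqP ai|/hecke_refl_absorb[-> ->] //].
have Ei : refl a i = i.
  apply: root_inj; rewrite reflE reflection_rootE.
  suff -> : '[val i, coroot a] = 0 by rewrite scale0r subr0.
  by apply/eqP; rewrite dot_coroot_eq0 dotC ai.
rewrite hecke_refl_simple ?refl_weyl // hecke_simple_refl ?refl_weyl // reflV Ei.
by rewrite pos_simple // (weyl_conj i (refl_weyl a)) Ei.
Qed.

End SimpleReflection.

(** Along [pos_ind], every raising reflection is a Hecke conjugation by s_i. Restricting the letters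
    to the support of a reduces commutation with s_a, and the bound by w_P, to simple
    reflections. *)
Lemma refl_hprod a : pos a -> exists2 t,
  all (fun b : root => (b \in Delta) && (0 < cf b (val a))%R) t & refl a = hprod t.
Proof.
move: a; apply: pos_ind => [i iD|i a iD pa _ ai [t tP E] ci].
  by exists [:: i]; rewrite ?hprod1 //= iD cf_simple // eqxx ltr01.
exists (i :: t ++ [:: i]).
  rewrite /= all_cat /= iD ci !andbT; apply: sub_all tP => b /andP[-> b0] /=.
  by have [->//|bi] := eqVneq b i; rewrite cf_reflection_simple.
by rewrite (hecke_refl_conj pa iD ai) [hprod _]/= -/(hprod _) hprod_cat hprod1 E.
Qed.

Lemma hecke_refl_comm_support a c : pos a -> pos c ->
  (forall i, i \in Delta -> 0 < cf i (val c) -> 0 <= '[val a, val i])%R ->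
  refl a ** refl c = refl c ** refl a.
Proof.
move=> pa pc h; have [t tP ->] := refl_hprod pc.
elim: t tP => [|i t IH] /=; first by rewrite hecke1r ?hecke1l ?refl_weyl.
move=> /andP[/andP[iD ci] /IH E].
rewrite heckeA ?refl_weyl ?hprod_weyl // hecke_refl_comm ?h //.
by rewrite -heckeA ?refl_weyl ?hprod_weyl // E heckeA ?refl_weyl ?hprod_weyl.
Qed.

Lemma hprod_comm u s : u \in W -> (forall a, a \in s -> u ** refl a = refl a ** u) ->
  u ** hprod s = hprod s ** u.
Proof.
move=> uW; elim: s => [_|a s IH h] /=; first by rewrite hecke1r ?hecke1l.
rewrite heckeA ?refl_weyl ?hprod_weyl // h ?mem_head //.
rewrite -!heckeA ?refl_weyl ?hprod_weyl // IH // => b bs.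
by rewrite h // inE bs orbT.
Qed.

(** * Parabolic subgroups, w_P and minimal representatives *)

Section Parabolic.
Variable P : {set root}.
Hypothesis PD : P \subset Delta.
Local Notation wP := (longest P : {perm root}).

Lemma parabolic_weyl w : w \in parabolic P -> w \in W.
Proof.
apply: subsetP; apply: genS; apply/subsetP => _ /imsetP[b _ ->].
by rewrite imset_f.
Qed.

Lemma refl_parabolic b : b \in P -> refl b \in parabolic P.
Proof. by move=> bP; rewrite mem_gen // imset_f. Qed.

Lemma prodw_parabolic t : all (fun b => b \in P) t -> prodw t \in parabolic P.
Proof.
elim: t => [_|b t IH /andP[bP tP]]; first by rewrite /prodw big_nil group1.
by rewrite prodw_cons groupM ?refl_parabolic ?IH.
Qed.

Lemma longest_parabolic : wP \in parabolic P.
Proof. by rewrite /longest; case: arg_maxnP => //; exact: group1. Qed.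

Lemma longest_max w : w \in parabolic P -> (wlength w <= wlength wP)%N.
Proof. by rewrite /longest; case: arg_maxnP => [|v _]; [exact: group1|exact]. Qed.

Lemma longest_weyl : wP \in W.
Proof. exact/parabolic_weyl/longest_parabolic. Qed.

Lemma longest_neg b : b \in P -> ~~ pos (wP b).
Proof.
move=> bP; have bD := subsetP PD _ bP.
rewrite -wlength_refl_gt ?longest_weyl ?pos_simple // -leqNgt longest_max //.
by rewrite groupM ?refl_parabolic ?longest_parabolic.
Qed.

Lemma longest_absorbl b : b \in P -> refl b ** wP = wP.
Proof.
move=> bP; rewrite hecke_simple_refl ?longest_weyl ?(subsetP PD) //.
by rewrite (negbTE (longest_neg bP)).
Qed.

Lemma longest_absorbr b : b \in P -> wP ** refl b = wP.
Proof.
move=> bP; have bD := subsetP PD _ bP.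
rewrite hecke_refl_simple ?longest_weyl // -wlength_mulr_gt ?longest_weyl ?pos_simple //.
by rewrite ltnNge longest_max // groupM ?refl_parabolic ?longest_parabolic.
Qed.

Lemma hprod_longest t : all (fun b => b \in P) t -> hprod t ** wP = wP.
Proof.
elim: t => [_|b t IH /andP[bP tP]] /=; first by rewrite hecke1l ?longest_weyl.
by rewrite -heckeA ?refl_weyl ?hprod_weyl ?longest_weyl // IH // longest_absorbl.
Qed.

Lemma hprod_le_longest t : all (fun b => b \in P) t -> bruhat (hprod t) wP.
Proof.
move=> tP; rewrite -(hprod_longest tP) bruhat_heckel ?hprod_weyl //.
exact: longest_weyl.
Qed.

Lemma mull_le_hecke i u : i \in Delta -> u \in W -> bruhat (refl i * u) (refl i ** u).
Proof.
move=> iD uW; have uVW : u^-1 \in W by rewrite groupV.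
have := mulr_le_hecke_simple uVW iD; rewrite -[hecke_simple _ _]invgK.
rewrite -lhecke_simpleV // invgK => /bruhatV.
rewrite groupM ?refl_weyl // invMg invgK reflV => /(_ isT).
by rewrite invgK hecke_simple_refl.
Qed.

Lemma hprod_ge_parabolic w : w \in parabolic P ->
  exists2 t, all (fun b => b \in P) t & bruhat w (hprod t).
Proof.
move: w; apply: gen_ind => [|_ w /imsetP[b bP ->] wP' [t tP wt]].
  by exists [::]; rewrite ?bruhat_refl.
have wW := parabolic_weyl wP'.
exists (b :: t); rewrite /= ?bP //.
apply: bruhat_trans (mull_le_hecke (subsetP PD _ bP) wW) _.
by apply: hecke_mono; rewrite ?refl_weyl ?bruhat_refl.
Qed.

(** Turns w_P into the product of a list, so that w_P can be accounted for as part of a degree. *)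
Lemma longest_hprod : exists2 t, all (fun b => b \in P) t & wP = hprod t.
Proof.
have [t tP h] := hprod_ge_parabolic longest_parabolic; exists t => //.
by apply: bruhat_anti h _; [exact: longest_weyl | exact: hprod_le_longest].
Qed.

(** Each factor s_b keeps the bound: u s_b lies below u . s_b, hence below y . s_b = y. Applied with
    v the inverse of w_P, it bounds z by z w_P. *)
Lemma mul_parabolic_le y u v : y \in W -> (forall b, b \in P -> y ** refl b = y) ->
  u \in W -> bruhat u y -> v \in parabolic P -> bruhat (u * v) y.
Proof.
move=> yW yP uW uy vP; move: v vP u uW uy.
apply: (@gen_ind _ _ (fun v => forall u, u \in W -> bruhat u y -> bruhat (u * v) y)).
  by move=> u _; rewrite mulg1.
move=> _ v /imsetP[b bP ->] _ IH u uW uy; have bD := subsetP PD _ bP.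
rewrite mulgA; apply: IH; first by rewrite groupM ?refl_weyl.
apply: bruhat_trans (mulr_le_hecke_simple uW bD) _.
have -> : hecke_simple u b = u ** refl b by rewrite hecke_simpleE ?hecke_refl_simple.
by rewrite -(yP b bP); apply: hecke_mono; rewrite ?refl_weyl ?bruhat_refl.
Qed.

Definition in_span a := forall j, j \notin P -> cf j (val a) = 0%R.

Lemma parabolic_span w a : w \in parabolic P -> in_span a -> in_span (w a).
Proof.
move=> wP' ; move: w wP' a.
apply: (@gen_ind _ _ (fun w => forall a, in_span a -> in_span (w a))) => [a|].
  by rewrite perm1.
move=> _ v /imsetP[b bP ->] _ IH a ha; rewrite permM; apply: IH => j jP.
rewrite reflE reflection_rootE cfB ha // cfZ sub0r.
have [jD|jD] := boolP (j \in Delta); last by rewrite cf_out // mulr0 oppr0.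
rewrite (cf_simple jD (subsetP PD _ bP)).
by case: eqVneq jP => [->|_ _]; rewrite ?bP // mulr0 oppr0.
Qed.

Lemma simple_in_span b : b \in P -> in_span b.
Proof.
move=> bP j jP; have [jD|jD] := boolP (j \in Delta); last exact: cf_out.
rewrite (cf_simple jD (subsetP PD _ bP)).
by case: eqVneq jP => [->|//]; rewrite bP.
Qed.

Lemma cf_weyl_span w a j : w \in W -> in_span a ->
  cf j (val (w a)) = (\sum_(b in P) cf b (val a) * cf j (val (w b)))%R.
Proof.
move=> /weyl_isometric[f [lf _ wf]] sa.
have f0 : f 0%R = 0%R.
  by have := lf (-1)%R 0%R 0%R; rewrite scaler0 addr0 scaleN1r addNr.
have fS (r : seq root) (k : root -> R) :
    f (\sum_(b <- r | b \in P) k b *: val b)%R =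
    (\sum_(b <- r | b \in P) k b *: f (val b))%R.
  elim: r => [|b r IH]; first by rewrite !big_nil.
  by rewrite !big_cons; case: ifP => // _; rewrite -IH lf.
have aE : val a = (\sum_(b in P) cf b (val a) *: val b)%R.
  rewrite {1}(cf_sum Phi (val a)) [RHS]big_mkcond [LHS]big_mkcond.
  apply: eq_bigr => b _; case: ifP => bD; case: ifP => bP //.
    by rewrite sa ?scale0r ?bP.
  by rewrite (subsetP PD) // in bD.
rewrite wf {1}aE fS raddf_sum /=; apply: eq_bigr => b _.
by rewrite cfZ -wf.
Qed.

Lemma pos_weyl_span w a : w \in W -> in_span a -> pos a ->
  (forall b, b \in P -> pos (w b)) -> pos (w a).
Proof.
move=> wW sa pa h; apply/posP => j _; rewrite cf_weyl_span //.
by apply: sumr_ge0 => b bP; rewrite mulr_ge0 ?pos_cf ?h.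
Qed.

Lemma neg_weyl_span w a : w \in W -> in_span a -> pos a ->
  (forall b, b \in P -> ~~ pos (w b)) -> ~~ pos (w a).
Proof.
move=> wW sa pa h; rewrite -pos_oppE; apply/posP => j _.
rewrite cf_opp cf_weyl_span // -sumrN; apply: sumr_ge0 => b bP.
by rewrite -mulrN mulr_ge0 ?pos_cf // -cf_opp pos_cf // pos_oppE h.
Qed.

(* As z^-1 sends R_P^+ to positive roots, the length grows along z times the
   prefixes of a word in P that is reduced. *)
Lemma le_mul_parabolic z v : z \in W -> (forall b, b \in P -> pos (z^-1 b)) ->
  v \in parabolic P -> (wlength z <= wlength (z * v))%N.
Proof.
move=> zW zP vP.
have [t tP <-] : exists2 t, all (fun b => b \in P) t & prodw t = v.
  move: v vP; apply: gen_ind => [|_ v /imsetP[b bP ->] _ [t tP <-]].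
    by exists [::]; rewrite /prodw ?big_nil.
  by exists (b :: t); rewrite ?prodw_cons //= bP.
have [n] := ubnP (size t); elim: n t tP => // n IH t.
elim/last_ind: t => [|t b _]; first by rewrite /prodw big_nil mulg1.
rewrite all_rcons size_rcons ltnS => /andP[bP tP] tn; rewrite prodw_rcons mulgA.
have bD := subsetP PD _ bP.
have tW : prodw t \in W := prodw_weyl t.
have [pb|nb] := boolP (pos ((prodw t)^-1 b)).
  apply: leq_trans (IH _ tP tn) (ltnW _).
  rewrite wlength_mulr_gt ?groupM //; last exact: pos_simple.
  rewrite invMg permM.
  apply: pos_weyl_span; rewrite ?groupV //.
  apply: parabolic_span (simple_in_span bP); rewrite groupV.
  exact: prodw_parabolic.
(* Otherwise appending b to t does not increase the length, and [exchange] rewrites the product as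
   that of a shorter word in P. *)
have rtP : all (fun b => b \in P) (rev t) by rewrite all_rev.
rewrite prodwV in nb; have [s [sP ss E]] := exchange PD rtP (pos_simple bD) nb.
have -> : z * prodw t * refl b = z * prodw (rev s).
  by rewrite -prodwV -E -prodwV invMg invgK reflV mulgA.
apply: IH; first by rewrite all_rev.
by rewrite size_rev; apply: leq_ltn_trans tn; rewrite -(size_rev t) ltnW.
Qed.

(** Absorption means that y^-1 makes every b in P negative. Since w_P also makes them negative
    within their span, z = y w_P^-1 has z^-1 b positive, which is minimality in the coset. *)
Lemma min_reps_mul_longest y : y \in W -> (forall b, b \in P -> y ** refl b = y) ->
  exists2 z, z \in min_reps P & z * wP = y.
Proof.
move=> yW yP; exists (y * wP^-1); last by rewrite mulgKV.
have zW : y * wP^-1 \in W by rewrite groupM ?groupV ?longest_weyl.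
rewrite inE zW /=; apply/forall_inP => v vP; apply: le_mul_parabolic => // b bP.
rewrite invMg invgK permM.
have yneg c : c \in P -> ~~ pos (y^-1 c).
  move=> cP; have := yP c cP; rewrite hecke_refl_simple ?(subsetP PD) //.
  case: ifP => // _ /eqP; rewrite -{2}[y]mulg1 (inj_eq (mulgI y)) => /eqP.
  move=> /(congr1 (fun w : {perm root} => w c)).
  rewrite refl_simple perm1 => /(congr1 (fun a : root => pos a)).
  by rewrite pos_oppE; case: (pos c).
have := @neg_weyl_span y^-1 (opp_root (wP b)).
rewrite groupV weyl_opp ?groupV // !pos_oppE negbK => -> //.
- move=> j jP; rewrite cf_opp (parabolic_span longest_parabolic (simple_in_span bP)) ?oppr0 //.
- exact: longest_neg.
Qed.

End Parabolic.
End Bruhat.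

(** * Greedy products are maximal *)

Section GreedyMaximum.
Variables (R : realType) (V : vectType R) (Phi : basedRootSystem V).

Local Notation root := (rootset Phi).
Local Notation Delta := (simples Phi).
Local Notation "''[' u , v ]" := (rform Phi u v) : ring_scope.
Local Notation val a := (fsval a).
Local Notation cf := (@cf R V Phi).
Local Notation W := (weyl Phi).
Local Notation "u ** v" := (hecke u v) (at level 40, left associativity).
Local Notation eff0 := (@eff R V Phi set0).
Local Notation maxr0 := (@maxr R V Phi set0).
Local Notation greedy0 := (@vgreedy R V Phi set0).
Local Notation height0 := (@height R V Phi set0).

Implicit Types (a b c d i : root) (x y : V) (u v w : {perm root}) (s t g : seq root).

(** * Letters of a greedy list: commutation and absorption *)

Definition weight s : V := \sum_(a <- s) coroot a.

Lemma weight_cons a s : weight (a :: s) = coroot a + weight s.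
Proof. by rewrite /weight big_cons. Qed.

Lemma weight_cat s t : weight (s ++ t) = weight s + weight t.
Proof. by rewrite /weight big_cat. Qed.

Lemma weight_nil : weight [::] = 0.
Proof. by rewrite /weight big_nil. Qed.

Lemma greedy0_weight x g : greedy0 x g -> x = weight g.
Proof.
elim: g x => [|a g IH] x /=.
  move=> h; rewrite weight_nil; apply: (@ccf_inj _ _ Phi) => b.
  by rewrite h ?inE // raddf0.
by move=> [_ /IH E]; rewrite weight_cons -E addrC subrK.
Qed.

Lemma cf_weight_gt0 s c i : all pos s -> c \in s -> 0 < cf i (val c) -> 0 < cf i (weight s).
Proof.
move=> ps cs ci; have cor a : pos a -> 0 <= cf i (coroot a).
  by move=> pa; rewrite corootE cfZ mulr_ge0 ?pos_cf // ltW ?coroot_scale_gt0.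
elim: s ps cs => //= a s IH /andP[pa ps]; rewrite inE weight_cons cfD => /orP[/eqP <-|cs].
  rewrite ltr_pwDl //; first by rewrite corootE cfZ mulr_gt0 ?coroot_scale_gt0.
  by rewrite -ccf_ge0 natr_ge0 // (eff_sum (P := set0)) ?inE.
by rewrite ltr_wpDl ?cor ?IH.
Qed.

Lemma greedy0_comm x g : greedy0 x g ->
  {in g &, forall a c, refl a ** refl c = refl c ** refl a}.
Proof.
elim: g x => // a g IH x /= [ma gg].
have pg := vgreedy_pos gg; have xE := greedy0_weight gg.
have H c : c \in g -> refl a ** refl c = refl c ** refl a.
  move=> cg; apply: hecke_refl_comm_support; first by case: ma.
    exact: (allP pg).
  move=> i iD ci; apply: maxr_dot_ge0 ma iD _.
  by rewrite xE (cf_weight_gt0 pg cg).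
move=> b c; rewrite !inE => /orP[/eqP->|bg] /orP[/eqP->|cg] //; first exact: H.
  by rewrite H.
exact: (IH _ gg).
Qed.

Lemma dot_weight s i : '[weight s, val i] = \sum_(a <- s) '[coroot a, val i].
Proof. by rewrite dot_suml. Qed.

Lemma dot_corootl_gt0 a i : (0 < '[coroot a, val i]) = (0 < '[val a, val i]).
Proof. by rewrite dotC dot_coroot_gt0 dotC. Qed.

(** The letter c absorbs s_i on both sides and commutes with the other letters, so it can be moved
    to either end of the product. *)
Lemma greedy0_letter_absorb x g i c : greedy0 x g -> i \in Delta ->
  c \in g -> 0 < '[coroot c, val i] ->
  refl i ** hprod g = hprod g /\ hprod g ** refl i = hprod g.
Proof.
move=> gg iD cing ci.
have pg := vgreedy_pos gg; have cg := greedy0_comm gg.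
have pc := allP pg _ cing.
have [a1 a2] : refl c ** refl i = refl c /\ refl i ** refl c = refl c.
  by apply: hecke_refl_absorb; rewrite -?dot_corootl_gt0.
case/splitPr: cing cg => g1 g2 cg.
have rW := @refl_weyl _ _ Phi; have hW := @hprod_weyl _ _ Phi.
have E1 : refl c ** hprod g1 = hprod g1 ** refl c.
  by apply: hprod_comm => // a ag; apply: cg; rewrite mem_cat ?inE ?ag ?eqxx ?orbT.
have E2 : refl c ** hprod g2 = hprod g2 ** refl c.
  by apply: hprod_comm => // a ag; apply: cg; rewrite mem_cat ?inE ?ag ?eqxx ?orbT.
rewrite hprod_cat [hprod (c :: g2)]/= -/(hprod g2); split.
  by rewrite (heckeA (hW g1)) // -E1 -heckeA ?hecke_weyl // heckeA ?hecke_weyl // a2.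
by rewrite E2 -heckeA ?hecke_weyl // -heckeA // a1.
Qed.

Lemma greedy0_absorb x g i : greedy0 x g -> i \in Delta -> 0 < '[x, val i] ->
  refl i ** hprod g = hprod g /\ hprod g ** refl i = hprod g.
Proof.
move=> gg iD; rewrite {1}(greedy0_weight gg) dot_weight => x0.
case: (pselect (exists2 c, c \in g & 0 < '[coroot c, val i])) => [[c cg ci]|h].
  exact: greedy0_letter_absorb gg iD cg ci.
move: x0; rewrite ltNge big_seq sumr_le0 // => c cing; rewrite leNgt.
by apply: contra_notN h => h; exists c.
Qed.

(** Either some letter pairs positively with i and s_i is absorbed on both sides, or all pairings
    are at most 0 with nonnegative sum, hence 0, and every letter commutes with s_i. *)
Lemma greedy0_simple_comm x g i : greedy0 x g -> i \in Delta -> 0 <= '[x, val i] ->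
  refl i ** hprod g = hprod g ** refl i.
Proof.
move=> gg iD; rewrite {1}(greedy0_weight gg) dot_weight => x0.
case: (pselect (exists2 c, c \in g & 0 < '[coroot c, val i])) => [[c cg ci]|h].
  by have [-> ->] := greedy0_letter_absorb gg iD cg ci.
have le0 c : c \in g -> '[coroot c, val i] <= 0.
  by move=> cg; rewrite leNgt; apply: contra_notN h => h; exists c.
have : \sum_(c <- g | c \in g) - '[coroot c, val i] == 0.
  rewrite eq_le sumrN oppr_le0 -big_seq x0 oppr_ge0 big_seq; exact: sumr_le0.
rewrite psumr_eq0 => [/allP eq0|c /le0]; last by rewrite oppr_ge0.
apply: hprod_comm (refl_weyl i) _ => c cg; apply/esym.
apply: hecke_refl_comm => //; first exact: allP (vgreedy_pos gg) _ cg.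
have := eq0 c cg; rewrite cg oppr_eq0 dotC dot_coroot_eq0 dotC => /eqP ->.
exact: lexx.
Qed.

Lemma eff_dot_le0 x i : eff0 x -> i \in Delta -> cf i x = 0 -> '[x, val i] <= 0.
Proof.
move=> ex iD ci; rewrite dot_cf sumr_le0 // => b bD.
have [->|bi] := eqVneq b i; first by rewrite ci mul0r.
by rewrite mulr_ge0_le0 ?simple_dot_le0 // (eff_cf_ge0 ex) ?inE.
Qed.

Lemma eff_dot_gt0 x i : eff0 x -> i \in Delta -> 0 < '[x, val i] -> 0 < cf i x.
Proof.
move=> ex iD xi; rewrite lt0r (eff_cf_ge0 ex) ?inE // andbT.
by apply: contraTneq xi => /(eff_dot_le0 ex iD); rewrite -leNgt.
Qed.

(** * The induction for G/B *)

Definition below x s : Prop := all pos s /\ eff0 (x - weight s).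

Lemma below_greedy x g : greedy0 x g -> below x g.
Proof.
move=> gg; split; first exact: vgreedy_pos gg.
by rewrite -(greedy0_weight gg) subrr; exact: eff_zero.
Qed.

Lemma bruhat_refl_reflection i b : pos b -> i \in Delta -> b != i -> 0 < '[val b, val i] ->
  refl b = refl i ** (refl (reflection_root i b) ** refl i).
Proof.
move=> pb iD bi dbi; rewrite -{1}(reflection_rootK i b) hecke_refl_conj //.
  exact: pos_reflection_simple.
rewrite reflection_rootE dotBl dotZl dot_coroot_sqn; lra.
Qed.

(** Proved jointly with [peels]: peeling at x uses both statements at smaller heights, and
    domination at x uses peeling at x itself. *)
Definition dominates x : Prop :=
  forall g s, greedy0 x g -> below x s -> bruhat (hprod s) (hprod g).
Definition peels x : Prop :=
  forall i s, i \in Delta -> 0 < '[x, val i] -> below x s ->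
  exists2 s', below (x - coroot i) s' &
    bruhat (hprod s) (refl i ** (hprod s' ** refl i)).

Let PD0 : set0 \subset Delta := sub0set _.

Lemma height_sub_coroot x a : pos a -> height0 (x - coroot a) + 1 <= height0 x.
Proof.
move=> pa; rewrite heightB; have := height_coroot_ge1 pa (outside0 pa); lra.
Qed.

(** The head b of the list is compared with i through the sign of (b^vee, i). An s_i missing at
    either end may be inserted freely, since Hecke multiplication only increases; the point is to
    free one i^vee from the degree. *)
Lemma peels_step x : eff0 x ->
  (forall y, eff0 y -> height0 y + 1 <= height0 x -> dominates y /\ peels y) -> peels x.
Proof.
move=> ex IH i s iD xi [ps es].
have rW := @refl_weyl _ _ Phi; have hW := @hprod_weyl _ _ Phi.
have pi := pos_simple iD; have ri := bruhat_refl (refl i).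
have exi : eff0 (x - coroot i).
  exact: eff_sub_simple ex iD (eff_dot_gt0 ex iD xi).
case: s ps es => [_ _|b s /= /andP[pb ps]].
  exists [::]; first by split; rewrite // weight_nil subr0.
  by rewrite bruhat1 ?hecke_weyl.
rewrite weight_cons opprD addrA => es; set f := x - coroot b.
have ef : eff0 f by have := effD es (eff_sum (P := set0) ps); rewrite subrK.
have hf := height_sub_coroot x pb; have [domf peelf] := IH f ef hf.
have [g gg] := vgreedy_ex PD0 ef; have gf := greedy0_weight gg.
have pg := vgreedy_pos gg.
(* Domination at f replaces the tail by a greedy product, for which commutation with s_i is
   available. *)
have le : bruhat (hprod (b :: s)) (refl b ** hprod g).
  by apply: hecke_mono; rewrite ?bruhat_refl //; apply: domf gg _.
suff [s' s'x h] : exists2 s', below (x - coroot i) s' &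
    bruhat (refl b ** hprod g) (refl i ** (hprod s' ** refl i)).
  by exists s' => //; exact: bruhat_trans h.
have fi : '[f, val i] = '[x, val i] - '[coroot b, val i] by rewrite dotBl.
have bZ := dot_coroot_intC i b.
have [bi|bi] := eqVneq b i.
  exists g; first by split; rewrite // -gf /f bi subrr; exact: eff_zero.
  by rewrite bi; apply: hecke_mono; rewrite ?bruhat_heckel ?hecke_weyl.
have [c0|c0|c0] := ltgtP '[coroot b, val i] 0.
- (* Removing i twice from f leaves a greedy product commuting with s_i. *)
  have fi2 : 2 <= '[f, val i].
    have nbZ : - '[coroot b, val i] \is a Num.int by rewrite rpredN.
    have := int_gt0_ge1 nbZ; rewrite oppr_gt0 => /(_ c0).
    have := int_gt0_ge1 (eff_dot_int i ex) xi; lra.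
  have fi0 : 0 < '[f, val i] by lra.
  have [s2 s2f h2] := peelf i g iD fi0 (below_greedy gg).
  have efi : eff0 (f - coroot i) := eff_sub_simple ef iD (eff_dot_gt0 ef iD fi0).
  have hfi : height0 (f - coroot i) + 1 <= height0 x.
    by have := height_sub_coroot f pi; lra.
  have [domfi _] := IH _ efi hfi.
  have [g2 gg2] := vgreedy_ex PD0 efi; have pg2 := vgreedy_pos gg2.
  have C2 : refl i ** hprod g2 = hprod g2 ** refl i.
    by apply: greedy0_simple_comm gg2 iD _; rewrite dotBl dot_rootKC; lra.
  exists (b :: g2).
    split; first by rewrite /= pb pg2.
    have -> : x - coroot i - weight (b :: g2) = 0.
      by rewrite weight_cons -(greedy0_weight gg2) addrA [coroot b + _]addrC subrK subrr.
    exact: eff_zero.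
  apply: bruhat_trans (bruhat_hecker _ _); rewrite ?hecke_weyl //=.
  rewrite -heckeA //; apply: hecke_mono; rewrite ?bruhat_refl //.
  apply: bruhat_trans h2 _.
  have -> : hprod g2 ** refl i = refl i ** (hprod g2 ** refl i).
    by rewrite -C2 heckeA // hecke_simpleK.
  apply: hecke_mono; rewrite ?hecke_weyl //; apply: hecke_mono; rewrite ?bruhat_refl //.
  exact: domfi gg2 s2f.
(* Now s_b = s_i . s_b' . s_i. If k = (b^vee, i) is 1, the inner s_i passes across g. If k is at
   least 2, it stays as a letter: b'^vee + i^vee = b^vee - (k - 1) i^vee is still at most b^vee -
   i^vee. *)
- set b' := reflection_root i b.
  have pb' : pos b' := pos_reflection_simple iD pb bi.
  have dbi : 0 < '[val b, val i] by rewrite -dot_corootl_gt0.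
  have Eb := bruhat_refl_reflection pb iD bi dbi.
  have Eb' : coroot b' = coroot b - '[coroot b, val i] *: coroot i.
    exact: coroot_reflection.
  have [c1|c2] := int_eq1_or_ge2 bZ c0.
    have C : refl i ** hprod g = hprod g ** refl i.
      apply: greedy0_simple_comm gg iD _.
      have := int_gt0_ge1 (eff_dot_int i ex) xi; lra.
    exists (b' :: g).
      split; first by rewrite /= pb' pg.
      rewrite weight_cons -gf Eb' c1 scale1r /f.
      have -> : x - coroot i - (coroot b - coroot i + (x - coroot b)) = 0.
        by rewrite (addrC (coroot b - _)) addrA subrK subrr.
      exact: eff_zero.
    rewrite Eb /= -!heckeA ?hecke_weyl // C; exact: bruhat_refl.
  exists (b' :: i :: g).
    split; first by rewrite /= pb' pi pg.
    rewrite !weight_cons -gf Eb' /f.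
    have -> : x - coroot i - (coroot b - '[coroot b, val i] *: coroot i +
        (coroot i + (x - coroot b))) = ('[coroot b, val i] - 2) *: coroot i.
      move: (coroot b) (coroot i) '[_, _] => B I k.
      by apply: (@ccf_inj _ _ Phi) => j; rewrite !(ccfD, ccfN, ccfZ); ring.
    move=> j _; rewrite (ccfZ j (_ - 2)); apply: rpredM (ccf_coroot_nat j pi).
    rewrite natrEint; apply/andP; split; last lra.
    by apply: rpredB bZ _; exact: rpred_nat.
  have -> : refl b ** hprod g = refl i ** hprod (b' :: i :: g).
    by rewrite Eb /= -!heckeA ?hecke_weyl.
  apply: hecke_mono; rewrite ?bruhat_refl //.
  exact: bruhat_heckel.
(* Here b is orthogonal to i, so s_b commutes with s_i and it suffices to peel g. *)
- have fi0 : 0 < '[f, val i] by lra.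
  have [s2 [ps2 es2] h2] := peelf i g iD fi0 (below_greedy gg).
  exists (b :: s2).
    split; first by rewrite /= pb ps2.
    have -> // : x - coroot i - weight (b :: s2) = f - coroot i - weight s2.
    by rewrite weight_cons opprD addrA /f [x - _ - _]addrAC.
  apply: (@bruhat_trans _ _ _ (refl b ** (refl i ** (hprod s2 ** refl i)))).
    by apply: hecke_mono; rewrite ?bruhat_refl.
  rewrite heckeA ?hecke_weyl // hecke_refl_comm //.
    by rewrite -!heckeA ?hecke_weyl //=; exact: bruhat_refl.
  by move/eqP: c0; rewrite dotC dot_coroot_eq0 dotC => /eqP ->; exact: lexx.
Qed.

Lemma below_sub_simple x i s : i \in Delta -> below (x - coroot i) s -> below x s.
Proof.
move=> iD [ps es]; split=> //; move: es; rewrite addrAC.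
by apply: eff_subr; exact: pos_simple.
Qed.

(** In each case a greedy list of x - i^vee is exhibited whose product lies below that of a :: g;
    domination at x - i^vee then bounds s. *)
Lemma dominates_sub_simple x a g i s : eff0 x ->
  (forall y, eff0 y -> height0 y + 1 <= height0 x -> dominates y) ->
  greedy0 x (a :: g) -> i \in Delta -> 0 < '[x, val i] ->
  below (x - coroot i) s -> bruhat (hprod s) (hprod (a :: g)).
Proof.
move=> ex IH /= [ma gg] iD xi bs; have [pa oa ea am] := ma.
have rW := @refl_weyl _ _ Phi; have hW := @hprod_weyl _ _ Phi.
have pi := pos_simple iD.
have exi : eff0 (x - coroot i).
  exact: eff_sub_simple ex iD (eff_dot_gt0 ex iD xi).
have domi := IH _ exi (height_sub_coroot x pi).
have doma := IH _ ea (height_sub_coroot x pa).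
case: (pselect (eff0 (x - coroot a - coroot i))) => [eai|neai].
  (* If i^vee still fits beside a, then a stays maximal for x - i^vee, and domination at x - a^vee
     compares the two tails. *)
  have [g2 gg2] := vgreedy_ex PD0 eai.
  have gi : greedy0 (x - coroot i) (a :: g2).
    split; last by rewrite addrAC.
    split=> // [|b pb]; first by rewrite addrAC.
    by rewrite addrAC => /(eff_subr pi); exact: am.
  apply: bruhat_trans (domi _ _ gi bs) _; apply: hecke_mono; rewrite ?bruhat_refl //.
  apply: doma gg _; apply: (@below_sub_simple _ i) => //; exact: below_greedy.
have cia : cf i (x - coroot a) = 0.
  apply/eqP; apply: contra_notT neai => ci.
  by apply: eff_sub_simple; rewrite // lt0r ci (eff_cf_ge0 ea) ?inE.
have [ai|ai] := eqVneq a i.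
  rewrite ai in gg *; apply: bruhat_trans (domi _ _ gg bs) _ => /=.
  exact: bruhat_hecker.
(* With no i-coordinate left, x - a^vee pairs nonpositively with i, while x pairs positively. *)
have dai : 0 < '[val a, val i].
  rewrite -dot_corootl_gt0; have := eff_dot_le0 ea iD cia; rewrite dotBl.
  by move: xi; lra.
have [c1 mai] := maxr_reflect ma iD ai dai cia.
(* Removing (s_i a)^vee = a^vee - i^vee from x - i^vee leaves x - a^vee, so the same tail g
   continues the list. *)
have gi : greedy0 (x - coroot i) (reflection_root i a :: g).
  split=> //; rewrite coroot_reflection c1 scale1r.
  by rewrite opprB addrA subrK.
apply: bruhat_trans (domi _ _ gi bs) _ => /=; apply: hecke_mono; rewrite ?bruhat_refl //.
rewrite [X in bruhat _ X](bruhat_refl_reflection pa iD ai dai).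
apply: bruhat_trans (bruhat_hecker _ _); rewrite ?hecke_weyl //.
exact: bruhat_heckel.
Qed.

Lemma dominates_step x : eff0 x -> peels x ->
  (forall y, eff0 y -> height0 y + 1 <= height0 x -> dominates y) -> dominates x.
Proof.
move=> ex peel IH g s gg bs.
have rW := @refl_weyl _ _ Phi; have hW := @hprod_weyl _ _ Phi.
case: s bs => [_|b s bs]; first exact: bruhat1.
have x0 : x != 0.
  case: bs => /= /andP[pb ps]; rewrite weight_cons opprD addrA => es.
  have ef : eff0 (x - coroot b) by have := effD es (eff_sum (P := set0) ps); rewrite subrK.
  apply: contraTneq isT => E; have := height_sub_coroot x pb.
  have := height_ge0 ef; rewrite E; have -> : height0 0 = 0.
    by rewrite /height big1 // => c _; rewrite raddf0.
  lra.
have [i iD /andP[_ xi]] : exists2 i, i \in Delta & (0 < cf i x) && (0 < '[x, val i]).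
  by apply: ex_dot_gt0 x0 _ => c _; apply: (eff_cf_ge0 ex); rewrite inE.
have [s' bs' le] := peel i _ iD xi bs.
have [a1 a2] := greedy0_absorb gg iD xi.
apply: bruhat_trans le _; rewrite -a1 -{1}a2.
apply: hecke_mono; rewrite ?bruhat_refl ?hecke_weyl //.
apply: hecke_mono; rewrite ?bruhat_refl //.
case: g gg {a1 a2} => [/greedy0_weight|a g gg].
  by rewrite weight_nil => E; rewrite E eqxx in x0.
exact: dominates_sub_simple ex IH gg iD xi bs'.
Qed.

Lemma greedy0_max x g s : greedy0 x g -> below x s -> bruhat (hprod s) (hprod g).
Proof.
move=> gg; have ex : eff0 x.
  by rewrite (greedy0_weight gg); apply: eff_sum; exact: vgreedy_pos gg.
suff [dom _] : dominates x /\ peels x by exact: dom.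
move: x ex {g s gg}; apply: eff_ind => x ex IH.
have pe := peels_step ex IH; split=> //.
by apply: dominates_step => // y ey hy; case: (IH y ey hy).
Qed.

End GreedyMaximum.

(** * Parabolic degrees *)

Section Curves.
Variables (R : realType) (V : vectType R) (Phi : basedRootSystem V).

Local Notation root := (rootset Phi).
Local Notation Delta := (simples Phi).
Local Notation val a := (fsval a).
Local Notation cf := (@cf R V Phi).
Local Notation ccf := (@ccf R V Phi).
Local Notation W := (weyl Phi).
Local Notation "u ** v" := (hecke u v) (at level 40, left associativity).
Local Notation weight := (@weight R V Phi).
Local Notation eff0 := (@eff R V Phi set0).

Implicit Types (a b c i j : root) (x y : V) (P : {set root}).
Implicit Types (u v w z : {perm root}) (s t g : seq root).

(** * Classes of degrees and their coordinates *)

Lemma coroot_latticeP P x : P \subset Delta ->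
  x \in coroot_lattice P <->
  (forall b, ccf b x \is a Num.int) /\ (forall b, b \notin P -> ccf b x = 0).
Proof.
move=> PD; split=> [/asboolP[c ->]|[xZ x0]].
  have E j : ccf j (\sum_(b in P) coroot b *~ c b) = \sum_(b in P) (j == b)%:R *~ c b.
    rewrite raddf_sum; apply: eq_bigr => b bP; rewrite raddfMz /=; congr (_ *~ _).
    have [jD|jD] := boolP (j \in Delta); first by rewrite (ccf_simple jD (subsetP PD _ bP)).
    rewrite ccf_out //; case: eqVneq jD => [->|//].
    by rewrite (subsetP PD).
  split=> [j|j jP]; rewrite E.
    by apply: rpred_sum => b _; rewrite rpredMz // rpred_nat.
  by apply: big1 => b bP; case: eqVneq jP => [->|_ _]; rewrite ?bP // mul0rz.
apply/asboolP; exists (fun b => Num.floor (ccf b x)).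
rewrite {1}(ccf_sum Phi x) [RHS]big_mkcond [LHS]big_mkcond; apply: eq_bigr => b _.
have [bP|bP] := boolP (b \in P); last by rewrite x0 // scale0r if_same.
rewrite (subsetP PD _ bP) -scaler_int; congr (_ *: _).
by apply/esym/eqP; rewrite -intrEfloor.
Qed.

Lemma deg_ofB P x y : deg_of P (x - y) = deg_of P x - deg_of P y.
Proof. exact: raddfB. Qed.

Lemma deg_of0 P : deg_of P 0 = 0.
Proof. exact: raddf0. Qed.

Lemma deg_of_eq P x y : deg_of P x = deg_of P y <-> x - y \in coroot_lattice P.
Proof. by rewrite Quotient.idealrBE; split=> [/eqP|/eqP]. Qed.

Definition integral x : Prop := forall b, ccf b x \is a Num.int.

Lemma integralB x y : integral x -> integral y -> integral (x - y).
Proof. by move=> ix iy b; rewrite ccfB rpredB ?ix ?iy. Qed.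

Lemma eff_integral x : eff0 x -> integral x.
Proof. by move=> ex b; apply: intr_nat; apply: ex; rewrite inE. Qed.

Lemma integral_coroot a : pos a -> integral (coroot a).
Proof. by move=> /(@eff_coroot _ _ _ set0)/eff_integral. Qed.

Lemma integral_weight s : all pos s -> integral (weight s).
Proof. by move=> /(@eff_sum _ _ _ set0)/eff_integral. Qed.

(** Coordinates outside P are unchanged by adding elements of the coroot lattice of P, so the order
    on classes can be read off any integral representatives. *)
Lemma deg_leP P x y : P \subset Delta -> integral x -> integral y ->
  deg_le (deg_of P y) (deg_of P x) <-> eff P (x - y).
Proof.
move=> PD ix iy; rewrite /deg_le -deg_ofB.
have S (c : root -> nat) : \sum_(b in Delta :\: P) deg_of P (coroot b) *+ c b =
    deg_of P (\sum_(b in Delta :\: P) coroot b *+ c b).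
  by rewrite [RHS]raddf_sum; apply: eq_bigr => b _; rewrite raddfMn.
have C (c : root -> nat) j : ccf j (\sum_(b in Delta :\: P) coroot b *+ c b) =
    if j \in Delta :\: P then (c j)%:R else 0.
  have E b : b \in Delta :\: P -> ccf j (coroot b *+ c b) = if j == b then (c j)%:R else 0.
    rewrite inE => /andP[_ bD]; rewrite raddfMn /=.
    have [jD|jD] := boolP (j \in Delta).
      by rewrite (ccf_simple jD bD); case: eqVneq => [->|_]; rewrite ?mul0rn.
    rewrite ccf_out // mul0rn; case: eqVneq jD => [->|//]; by rewrite bD.
  rewrite raddf_sum /= (eq_bigr _ E); case: ifP => jDP.
    by rewrite (bigD1 j) //= eqxx big1 ?addr0 // => b /andP[_]; rewrite eq_sym => /negbTE->.
  by apply: big1 => b bDP; case: eqVneq jDP => [->|//]; rewrite bDP.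
split=> [[c] |exy].
  rewrite S => /deg_of_eq /(coroot_latticeP _ PD)[_ E] j jP.
  by have := E j jP; rewrite ccfB => /eqP; rewrite subr_eq0 C => /eqP ->; case: ifP.
exists (fun b => Num.truncn (ccf b (x - y))); rewrite S; apply/deg_of_eq.
apply/(coroot_latticeP _ PD); split=> [j|j jP]; rewrite ccfB C.
  apply: rpredB; first exact: integralB.
  by case: ifP => _; [exact: rpred_nat | exact: rpred0].
rewrite inE jP /=; have [jD|jD] := boolP (j \in Delta); last by rewrite ccf_out ?subr0.
by apply/eqP; rewrite subr_eq0 eq_sym -natrEtruncn exy.
Qed.

Lemma effective_lift P d : P \subset Delta -> effective (P := P) d ->
  exists x, [/\ integral x, eff P x & d = deg_of P x].
Proof.
move=> PD [c]; rewrite subr0 => E.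
pose x := \sum_(b in Delta :\: P) coroot b *+ c b.
have ex : eff0 x.
  rewrite /x; apply: big_ind => [|u v|b]; [exact: eff_zero | exact: effD |].
  rewrite inE => /andP[_ bD]; rewrite -scaler_nat; apply: eff_scale.
  exact/eff_coroot/pos_simple.
exists x; split; first exact: eff_integral.
  by move=> b _; apply: ex; rewrite inE.
by rewrite E [RHS]raddf_sum; apply: eq_bigr => b _; rewrite raddfMn.
Qed.

Lemma is_positive_inP P a : P \subset Delta -> pos a ->
  is_positive_in P a <-> ~~ outside P a.
Proof.
move=> PD pa; split=> [[_ /asboolP[c E]]|oa].
  apply/negP => /existsP[j /andP[jP]]; rewrite E raddf_sum /= big1 ?ltxx // => b bP.
  rewrite raddfMz /=; have [jD|jD] := boolP (j \in Delta); last by rewrite cf_out // mul0rz.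
  rewrite (cf_simple jD (subsetP PD _ bP)); case: eqVneq jP => [->|_ _]; rewrite ?bP // mul0rz //.
split; first exact/is_positiveP.
apply/asboolP; have [k [E|E]] := root_cf a.
  exists (fun b => (k b)%:Z); rewrite {1}(cf_sum Phi (val a)) [RHS]big_mkcond [LHS]big_mkcond.
  apply: eq_bigr => b _; have [bP|bP] := boolP (b \in P).
    by rewrite (subsetP PD _ bP) E ?(subsetP PD) // -scaler_int pmulrn.
  case: ifP => // bD; suff -> : cf b (val a) = 0 by rewrite scale0r.
  apply/eqP; rewrite eq_le pos_cf // andbT leNgt; apply: contra oa => b0.
  by apply/existsP; exists b; rewrite bP.
have [b bD] := pos_gt0 pa; by rewrite E // oppr_gt0 ltrn0.
Qed.

Lemma root_leP a b : root_le Phi (val a) (val b) <->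
  (forall c, cf c (val a) <= cf c (val b)).
Proof.
split=> [[c c0 E] j|h].
  have [jD|jD] := boolP (j \in Delta); last by rewrite !cf_out.
  by rewrite -subr_ge0 -cfB (cfP E).
exists (fun c => cf c (val b - val a)); first by move=> c; rewrite cfB subr_ge0.
exact: cf_sum.
Qed.

Lemma below_degP P x a : P \subset Delta -> integral x ->
  below_deg (deg_of P x) a <-> [/\ pos a, outside P a & eff P (x - coroot a)].
Proof.
move=> PD ix; split=> [[/is_positiveP pa na le]|[pa oa ea]].
  split=> //; last by apply/(deg_leP PD ix) => //; exact: integral_coroot.
  by apply: contra_notT na => oa; apply/is_positive_inP.
split; first exact/is_positiveP.
  by move/(is_positive_inP PD pa); rewrite oa.
by apply/(deg_leP PD ix) => //; exact: integral_coroot.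
Qed.

Lemma maximal_rootP P x a : P \subset Delta -> integral x ->
  maximal_root (deg_of P x) a <-> maxr P x a.
Proof.
move=> PD ix; split=> [[/(below_degP _ PD ix)[pa oa ea] am]|[pa oa ea am]].
  split=> // b pb eb ab; apply: am; last exact/root_leP.
  apply/(below_degP _ PD ix); split=> //.
  have [j /andP[jP ja]] := existsP oa; apply/existsP; exists j.
  by rewrite jP (lt_le_trans ja).
split; first exact/(below_degP _ PD ix).
by move=> b /(below_degP _ PD ix)[pb _ eb] /root_leP ab; exact: am.
Qed.

Lemma greedyP P x s : P \subset Delta -> integral x ->
  greedy (deg_of P x) s <-> vgreedy P x s.
Proof.
move=> PD ix; split.
  move E : (deg_of P x) => d gs; elim: gs x ix E => [|{}d a {}s ma _ IH] x ix E /=.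
    move: E; rewrite -(deg_of0 P) => /deg_of_eq /(coroot_latticeP _ PD)[_ h] b bP.
    by rewrite -(h b bP) subr0.
  have mxa : maxr P x a by apply/(maximal_rootP _ PD ix); rewrite E.
  split=> //; have [pa _ _ _] := mxa.
  by apply: IH; rewrite ?deg_ofB ?E //; apply: integralB (integral_coroot pa).
elim: s x ix => [|a s IH] x ix /= => [h|[ma gs]].
  suff -> : deg_of P x = 0 by constructor.
  rewrite -(deg_of0 P); apply/deg_of_eq/(coroot_latticeP _ PD).
  by split=> b; rewrite subr0 //; exact: h.
constructor; first exact/maximal_rootP.
rewrite -deg_ofB; apply: IH => //; apply: integralB => //.
by case: ma => pa _ _ _; exact: integral_coroot.
Qed.

(** * From G/P to G/B *)

Section Parabolic.
Variable P : {set root}.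
Hypothesis PD : P \subset Delta.
Local Notation wP := (longest P : {perm root}).

Lemma vgreedy_weight x s j : vgreedy P x s -> j \notin P -> ccf j x = ccf j (weight s).
Proof.
move=> gs jP; elim: s x gs => [|a s IH] x /=.
  by move=> ->; rewrite // weight_nil raddf0.
by move=> [_ /IH E]; rewrite weight_cons ccfD -E ccfB addrC subrK.
Qed.

Lemma weight_P t j : all (fun b => b \in P) t -> j \notin P -> ccf j (weight t) = 0.
Proof.
move=> tP jP; elim: t tP => [|b t IH] /=; first by rewrite weight_nil raddf0.
move=> /andP[bP /IH E]; rewrite weight_cons ccfD E addr0.
have [jD|jD] := boolP (j \in Delta); last exact: ccf_out.
rewrite (ccf_simple jD (subsetP PD _ bP)).
by case: eqVneq jP => [->|//]; rewrite bP.
Qed.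

Lemma word_pos t : all (fun b => b \in P) t -> all pos t.
Proof. by apply: sub_all => b bP; rewrite pos_simple ?(subsetP PD). Qed.

(** Outside P, [weight s + y] has the coordinates of x, and this persists as letters are removed. A
    competitor for G/B that dominates a letter of s is thus a competitor for G/P, so maximality
    carries over. *)
Lemma vgreedy_lift x y s g : vgreedy P x s -> eff0 y ->
  (forall j, j \notin P -> ccf j y = 0) -> vgreedy set0 y g ->
  vgreedy set0 (weight s + y) (s ++ g).
Proof.
move=> gs ey y0 gy; elim: s x gs => [|a s IH] x /=; first by rewrite weight_nil add0r.
move=> [[pa oa ea am] gs]; have ps := vgreedy_pos gs.
rewrite weight_cons -addrA; split; last by rewrite [coroot a + _]addrC addrK; exact: IH gs.
split=> //; first exact: outside0.
  by rewrite [coroot a + _]addrC addrK; apply: effD ey; exact: eff_sum.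
move=> b pb eb ab; apply: am => // j jP.
have <- : ccf j (coroot a + (weight s + y) - coroot b) = ccf j (x - coroot b).
  by rewrite !ccfB !ccfD y0 // -(vgreedy_weight gs jP) ccfB; ring.
by apply: eb; rewrite inE.
Qed.

Lemma hprod_span g : all pos g -> (forall c, c \in g -> in_span P c) ->
  bruhat (hprod g) wP.
Proof.
move=> pg hg; have [t tP ->] : exists2 t, all (fun b => b \in P) t & hprod g = hprod t.
  elim: g pg hg => [_ _|c g IH /= /andP[pc pg] hg]; first by exists [::].
  have [t tP ->] : exists2 t, all (fun b => b \in P) t & hprod g = hprod t.
    by apply: IH => // b bg; apply: hg; rewrite inE bg orbT.
  have [r rP ->] := refl_hprod pc; exists (r ++ t); last by rewrite hprod_cat.
  rewrite all_cat tP andbT; apply: sub_all rP => b /andP[_ cb].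
  by apply: contraTT cb => bP; rewrite (hg c (mem_head _ _)) ?ltxx.
exact: hprod_le_longest.
Qed.

Lemma vgreedy_max x s t : vgreedy P x s -> all pos t -> eff P (x - weight t) ->
  bruhat (hprod t ** wP) (hprod s ** wP).
Proof.
move=> gs pt et; have ps := vgreedy_pos gs.
have [l lP El] := longest_hprod PD; have pl := word_pos lP.
(* K is the part of [weight t] in the directions of P. It makes room for t there, and [weight l]
   makes room for w_P = H(l). *)
pose K := \sum_(b in P) ccf b (weight t) *: coroot b.
have et0 : eff0 (weight t) := eff_sum (P := set0) pt.
have KE j : ccf j K = if j \in P then ccf j (weight t) else 0.
  have E b : b \in P -> ccf j (ccf b (weight t) *: coroot b) =
      if j == b then ccf j (weight t) else 0.
    move=> bP; rewrite (ccfZ j (ccf _ _)); have [jD|jD] := boolP (j \in Delta).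
      rewrite (ccf_simple jD (subsetP PD _ bP)).
      by case: eqVneq => [->|_]; rewrite ?mulr1 ?mulr0.
    rewrite !(ccf_out _ jD) mulr0; by case: ifP.
  rewrite /K raddf_sum /= (eq_bigr _ E); case: ifP => jP.
    by rewrite (bigD1 j) //= eqxx big1 ?addr0 // => b /andP[_]; rewrite eq_sym => /negbTE->.
  by apply: big1 => b bP; case: eqVneq jP => [->|//]; rewrite bP.
have eK : eff0 (K + weight l).
  apply: effD; last exact: eff_sum.
  by move=> j _; rewrite KE; case: ifP => // _; apply: et0; rewrite inE.
have K0 j : j \notin P -> ccf j (K + weight l) = 0.
  by move=> jP; rewrite ccfD KE (negbTE jP) weight_P ?addr0.
have [g gg] := vgreedy_ex (sub0set _) eK; have pg := vgreedy_pos gg.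
have gsg := vgreedy_lift gs eK K0 gg.
have := greedy0_max gsg (s := t ++ l); rewrite !hprod_cat -El => h.
apply: bruhat_trans (h _) _.
  split; first by rewrite all_cat pt pl.
  rewrite weight_cat [weight t + _]addrC addrA addrKA.
  move=> j _; rewrite ccfB ccfD KE; case: ifP => [jP|/negbT jP].
    by rewrite addrK; apply: (eff_sum (P := set0) ps); rewrite inE.
  by rewrite addr0 -(vgreedy_weight gs jP) -ccfB et.
(* The degree of g has no coordinate outside P, so all its letters lie in the span of P and H(g) is
   bounded by w_P. *)
apply: hecke_mono; rewrite ?hprod_weyl ?bruhat_refl //.
apply: hprod_span => // c cg j jP; have pc := allP pg _ cg.
apply/eqP; rewrite eq_le pos_cf // andbT leNgt; apply/negP => cj.
have := cf_weight_gt0 pg cg cj; rewrite -(greedy0_weight gg) -ccf_gt0.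
by rewrite K0 ?ltxx.
Qed.

(** Replaces [zdeg] by the product of a concrete greedy list. The last bound lets z itself, without
    the factor w_P, be estimated as the left factor in (b). *)
Lemma zdegP x : integral x -> eff P x -> exists s,
  [/\ vgreedy P x s, zdeg (deg_of P x) \in W,
      (zdeg (deg_of P x) * wP)%g = hprod s ** wP &
      bruhat (zdeg (deg_of P x)) (hprod s ** wP)].
Proof.
move=> ix ex; have wW := longest_weyl P.
have absorb s b : b \in P -> hprod s ** wP ** refl b = hprod s ** wP.
  by move=> bP; rewrite -heckeA ?hprod_weyl ?refl_weyl // longest_absorbr.
suff [s [gs zW E]] : exists s, [/\ vgreedy P x s, zdeg (deg_of P x) \in W &
    (zdeg (deg_of P x) * wP)%g = hprod s ** wP].
  have yW : hprod s ** wP \in W by rewrite hecke_weyl ?hprod_weyl.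
  exists s; split=> //; rewrite -[X in bruhat X _](mulgK wP) E.
  apply: (mul_parabolic_le PD yW) => //; [exact: absorb | exact: bruhat_refl |].
  by rewrite groupV longest_parabolic.
rewrite /zdeg; case: pickP => /= [z /andP[zm /asboolP[s gs E]]|none].
  exists s; split; first exact/(greedyP _ PD ix).
    by move: zm; rewrite inE => /andP[].
  by rewrite E foldr_hecke.
(* The default value of the choice is excluded: H(s) . w_P absorbs P on the right, hence is z w_P
   for a minimal representative z. *)
have [s gs] := vgreedy_ex PD ex.
have yW : hprod s ** wP \in W by rewrite hecke_weyl ?hprod_weyl.
have [z zm zE] := min_reps_mul_longest PD yW (absorb s).
have := none z; rewrite zm /= => /asboolP[]; exists s; first exact/greedyP.
by rewrite foldr_hecke.
Qed.

End Parabolic.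

Lemma longest0 : longest set0 = 1%g :> {perm root}.
Proof.
have := longest_parabolic (set0 : {set root}); rewrite /parabolic /=.
by rewrite imset0 gen0 => /set1P.
Qed.

End Curves.

Theorem corollary4p12 (R : realType) (V : vectType R)
    (Phi : basedRootSystem V) (P : {set rootset Phi})
    (hP : P \subset simples Phi) (d : deg P) (hd : effective d) :
  [/\ (* a *)
      forall a : rootset Phi, is_positive a ->
        deg_le (deg_of P (coroot a)) d ->
        bruhat (hecke (refl a)
                  (zdeg (d - deg_of P (coroot a)) * longest P)%g)
               (zdeg d * longest P)%g,
      (* b *)
      forall d' : deg P, deg_le 0 d' -> deg_le d' d ->
        bruhat (hecke (zdeg d') (zdeg (d - d') * longest P)%g)
               (zdeg d * longest P)%g,
      (* c *)
      forall a : rootset Phi, maximal_root d a ->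
        hecke (refl a) (zdeg (d - deg_of P (coroot a)) * longest P)%g
          = (zdeg d * longest P)%g
    & (* d *)
      exists e0 : V,
        [/\ e0 \in coroot_lattice (simples Phi), deg_of P e0 = d
          & forall e : V, e \in coroot_lattice (simples Phi) ->
              deg_of P e = d ->
              deg_le (degB_of Phi e0) (degB_of Phi e) ->
              (zdeg d * longest P)%g = zB Phi e]].
Proof.
have [x [ix ex Ed]] := effective_lift hP hd; rewrite {}Ed {d hd}.
have wW := longest_weyl P.
have hW s := hprod_weyl (Phi := Phi) s.
have [s [gs _ Ez _]] := zdegP hP ix ex.
have ps := vgreedy_pos gs.
have [l lP El] := longest_hprod hP; have pl := word_pos hP lP.
rewrite Ez; split.
- move=> a /is_positiveP pa; have ia := integral_coroot pa.
  move=> /(deg_leP hP ix ia) ea; rewrite -deg_ofB.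
  have [s' [gs' _ -> _]] := zdegP hP (integralB ix ia) ea.
  have -> : hecke (refl a) (hecke (hprod s') (longest P)) =
      hecke (hprod (a :: s')) (longest P) by rewrite heckeA ?refl_weyl.
  apply: (vgreedy_max hP gs); first by rewrite /= pa (vgreedy_pos gs').
  move=> j jP; rewrite weight_cons opprD addrA ccfB -(vgreedy_weight gs' jP) subrr.
  exact: rpred0.
- move=> d' d'0 d'd.
  have [x' [ix' ex' Ed']] := effective_lift hP d'0; move: d'd; rewrite {}Ed' {d' d'0}.
  move=> /(deg_leP hP ix ix') exx'; rewrite -deg_ofB.
  have [s1 [gs1 z1W _ lez1]] := zdegP hP ix' ex'.
  have [s2 [gs2 _ -> _]] := zdegP hP (integralB ix ix') exx'.
  (* The left factor is bounded by H(s1) . w_P = H(s1 ++ l), and l contributes nothing to the degree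
     outside P. *)
  apply: (@bruhat_trans _ _ _ (hecke (hprod (s1 ++ l ++ s2)) (longest P))).
    rewrite !hprod_cat -El -!heckeA ?hecke_weyl // [hecke (hprod s1) _]heckeA ?hecke_weyl //.
    by apply: hecke_mono; rewrite ?hecke_weyl ?bruhat_refl.
  apply: (vgreedy_max hP gs).
    by rewrite !all_cat (vgreedy_pos gs1) pl (vgreedy_pos gs2).
  move=> j jP; rewrite !weight_cat !(ccfB, ccfD) -(vgreedy_weight gs1 jP).
  rewrite -(vgreedy_weight gs2 jP) (weight_P hP lP jP) add0r ccfB.
  by rewrite [ccf j x' + _]addrC subrK subrr rpred0.
- move=> a /(maximal_rootP _ hP ix) ma; have [pa _ ea _] := ma.
  have ia := integral_coroot pa; rewrite -deg_ofB.
  have [s' [gs' _ -> _]] := zdegP hP (integralB ix ia) ea.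
  have -> : hecke (refl a) (hecke (hprod s') (longest P)) =
      hecke (hprod (a :: s')) (longest P) by rewrite heckeA ?refl_weyl.
  (* Both a :: s' and s are greedy for x, so each product bounds the other. *)
  have gas : vgreedy P x (a :: s') by [].
  have self t : vgreedy P x t -> eff P (x - weight t).
    by move=> gt j jP; rewrite ccfB -(vgreedy_weight gt jP) subrr rpred0.
  apply: bruhat_anti; first by rewrite hecke_weyl.
    by apply: (vgreedy_max hP gs); [exact: (vgreedy_pos gas) | exact: self].
  by apply: (vgreedy_max hP gas); [exact: ps | exact: self].
have pe0 : all pos (s ++ l) by rewrite all_cat ps.
have ie0 := integral_weight pe0.
(* For e at least this degree, the list s ++ l, whose product is H(s) . w_P, is below e. *)
exists (weight (s ++ l)); split.
- by apply/coroot_latticeP => //; split=> // b bD; rewrite ccf_out.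
- apply/deg_of_eq/(coroot_latticeP _ hP); split; first exact: integralB.
  move=> j jP; rewrite ccfB weight_cat ccfD (weight_P hP lP jP) addr0.
  by rewrite -(vgreedy_weight gs jP) subrr.
move=> e /(coroot_latticeP _ (subxx _)) [ie _] /deg_of_eq /(coroot_latticeP _ hP) [_ ee].
move=> /(deg_leP (sub0set _) ie ie0) eff_e.
have ee0 : @eff _ _ Phi set0 e.
  by have := effD eff_e (eff_sum (P := set0) pe0); rewrite subrK.
have [g [gg _ Eg _]] := zdegP (sub0set _) ie ee0.
move: Eg; rewrite longest0 mulg1 hecke1r // => Eg; rewrite /zB /degB_of Eg.
apply: bruhat_anti; first by rewrite hecke_weyl.
  by rewrite El -hprod_cat; apply: (greedy0_max gg).
(* Conversely, a greedy list g of e has degree d modulo P, so H(g) . w_P is bounded by H(s) .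
   w_P. *)
apply: bruhat_trans (bruhat_heckel _ wW) _; first exact: hW.
apply: (vgreedy_max hP gs); first exact: (vgreedy_pos gg).
move=> j jP; rewrite ccfB -(vgreedy_weight gg) ?inE // -ccfB.
by rewrite -opprB ccfN ee // oppr0 rpred0.
Qed.
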